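(* Let $n\ge 1$ be an integer, let $f$ be any one of the functionals $\theta^t,\theta^l,\delta^t,\delta^l$ on $\mathcal{K}^n$, and let $K_0$ be an $n$-dimensional convex body. Then, for any $K\in\mathcal{K}^n$, we have $$f(K)\le e^{n\cdot\|K,K_0\|}f(K_0),$$ where $\|\cdot\|$ is the Banach-Mazur metric.
   Context: An $n$-dimensional convex body is a compact convex subset of Euclidean space $\mathbb{E}^n$ with nonempty interior; $\mathcal{K}^n$ is the family of all of them. $B^n$ is the closed unit ball centered at the origin. Let $\mathcal{T}^n$ be the family of all nonsingular affine linear transformations from $\mathbb{E}^n$ to $\mathbb{E}^n$. The Banach-Mazur metric is $$\|K_1,K_2\|=\log\min\{r:\ K_1\subseteq\sigma(K_2)\subseteq rK_1+\mathbf{x};\ \mathbf{x}\in\mathbb{E}^n;\ \sigma\in\mathcal{T}^n\},$$ with $\log$ the natural logarithm. Densities. A packing is a countable family of sets with pairwise disjoint interiors; a covering is a countable family of sets whose union is $\mathbb{E}^n$. For a family $\mathcal{F}$ of translates of $K$, put $D_R(\mathcal{F})=\frac{1}{\mathrm{vol}(RB^n)}\sum_{F\in\mathcal{F},\,F\cap RB^n\ne\emptyset}\mathrm{vol}(F)$. The density of a packing $\mathcal{F}$ is $\limsup_{R\to\infty}D_R(\mathcal{F})$, and the density of a covering $\mathcal{F}$ is $\liminf_{R\to\infty}D_R(\mathcal{F})$. Then $\delta^t(K)$, $\delta^l(K)$ are the maximal (supremal) densities of packings by, respectively, translates of $K$ and lattice translates of $K$ (families $\{K+\mathbf{x}:\mathbf{x}\in\Lambda\}$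 with $\Lambda$ a full-rank lattice). Likewise $\theta^t(K)$, $\theta^l(K)$ are the minimal (infimal) densities of coverings of $\mathbb{E}^n$ by, respectively, translates and lattice translates of $K$. *)

(* Defs.v *)
From mathcomp Require Import all_boot all_order all_algebra.
From mathcomp Require Import all_classical all_reals all_analysis.

Set Implicit Arguments.
Unset Strict Implicit.
Unset Printing Implicit Defensive.

Import Order.TTheory GRing.Theory Num.Theory.
Import numFieldNormedType.Exports.

Local Open Scope classical_set_scope.
Local Open Scope ring_scope.

(* E^n is 'rV[R]_n. Its library norm is the sup norm: this affects neither
   compactness nor interiors, but the Euclidean ball B^n has to be defined. *)

Definition translate (R : realType) (n : nat) (x : 'rV[R]_n)
  (K : set 'rV[R]_n) : set 'rV[R]_n := [set y + x | y in K].

Definition dilate (R : realType) (n : nat) (r : R)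
  (K : set 'rV[R]_n) : set 'rV[R]_n := [set r *: y | y in K].

Definition unit_ball (R : realType) (n : nat) : set 'rV[R]_n :=
  [set v | Num.sqrt (\sum_(i < n) v ord0 i ^+ 2) <= 1].

Definition convex_body (R : realType) (n : nat) (K : set 'rV[R]_n) : Prop :=
  [/\ compact K, convex_set K & interior K !=set0].

(* n-dimensional Lebesgue measure, as the iterated product of the Lebesgue
   measure of R: the recursive case is the library's product measure
   (product_measure1), with R^(m+1) split as R x R^m. *)
Fixpoint volume (R : realType) (n : nat) : set 'rV[R]_n -> \bar R :=
  match n return set 'rV[R]_n -> \bar R with
  | 0 => fun A => (\1_A (0%R : 'rV[R]_0))%:E
  | m.+1 => fun A =>
      \int[@lebesgue_measure R]_x
        volume [set v : 'rV[R]_m | A (row_mx (x%:M : 'rV[R]_1) v)]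
  end%E.

Definition nonsingular_affine (R : realType) (n : nat)
  (sigma : 'rV[R]_n -> 'rV[R]_n) : Prop :=
  exists (A : 'M[R]_n) (b : 'rV[R]_n),
    A \in unitmx /\ sigma = (fun v => v *m A + b).

(* The factor r has to be positive: with a negative r allowed, r *: K1 can
   contain sigma @` K2 for arbitrarily negative r and there is no minimum. *)
Definition banach_mazur (R : realType) (n : nat) (K1 K2 : set 'rV[R]_n) : R :=
  ln (inf [set r : R | 0 < r /\
    exists (x : 'rV[R]_n) (sigma : 'rV[R]_n -> 'rV[R]_n),
      [/\ nonsingular_affine sigma, K1 `<=` sigma @` K2
        & sigma @` K2 `<=` translate x (dilate r K1)]]).

Definition packing (R : realType) (n : nat) (F : set (set 'rV[R]_n)) : Prop :=
  countable F /\ trivIset F (@interior 'rV[R]_n).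

Definition covering (R : realType) (n : nat) (F : set (set 'rV[R]_n)) : Prop :=
  countable F /\ \bigcup_(A in F) A = setT.

Definition density_in_ball (R : realType) (n : nat) (F : set (set 'rV[R]_n))
  (rho : R) : \bar R :=
  let rhoB := dilate rho (@unit_ball R n) in
  (((fine (volume rhoB))^-1)%:E *
     \esum_(A in [set A | F A /\ A `&` rhoB !=set0]) volume A)%E.

Definition packing_density (R : realType) (n : nat)
  (F : set (set 'rV[R]_n)) : \bar R :=
  limf_esup (density_in_ball F) (pinfty_nbhs R).

Definition covering_density (R : realType) (n : nat)
  (F : set (set 'rV[R]_n)) : \bar R :=
  limf_einf (density_in_ball F) (pinfty_nbhs R).

Definition lattice (R : realType) (n : nat) (L : set 'rV[R]_n) : Prop :=
  exists B : 'M[R]_n, B \in unitmx /\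
    L = [set map_mx intr z *m B | z in [set: 'rV[int]_n]].

Definition translates (R : realType) (n : nat) (K X : set 'rV[R]_n) :
  set (set 'rV[R]_n) := [set translate x K | x in X].

Definition delta_t (R : realType) (n : nat) (K : set 'rV[R]_n) : \bar R :=
  ereal_sup [set packing_density (translates K X)
            | X in [set X | packing (translates K X)]].

Definition delta_l (R : realType) (n : nat) (K : set 'rV[R]_n) : \bar R :=
  ereal_sup [set packing_density (translates K L)
            | L in [set L | lattice L /\ packing (translates K L)]].

Definition theta_t (R : realType) (n : nat) (K : set 'rV[R]_n) : \bar R :=
  ereal_inf [set covering_density (translates K X)
            | X in [set X | covering (translates K X)]].

Definition theta_l (R : realType) (n : nat) (K : set 'rV[R]_n) : \bar R :=
  ereal_inf [set covering_density (translates K L)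
            | L in [set L | lattice L /\ covering (translates K L)]].

(* Main.v *)
(* The two sides are compared through lattice-point counts, so that no change of
   variables for the iterated integral is needed.  Cubes of a grid show that the
   volume of a body S is the limit of m^n #{z in Z^n : m z in S} as m tends to 0;
   this gives vol(r S + t) = r^n vol S.  A locally finite set X that is invariant
   under a full-rank lattice has a density nu: #(X `&` r S) ~ nu vol(S) r^n for
   every S, hence nu(X A) vol(S A) = nu(X) vol(S) for every nonsingular A, and the
   translates of K by X have density nu(X) vol(K) as a packing or as a covering.
   An arbitrary packing (covering) by translates is approximated by a periodic one:
   by pigeonhole some large cube contains at least (at most) the average number of
   translation vectors, and the vectors of this cube are repeated periodically with
   a small padding (overlap).  If K is contained in sigma(K0), itself contained in
   r K + x, then sigma^-1 carries a periodic packing by K to one by K0, and sigma a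
   periodic covering by K0 to one by K, at the cost of a factor at most r^n. *)

Require Import Defs.
From mathcomp Require Import all_boot all_order all_algebra finmap.
From mathcomp Require Import all_classical all_reals all_analysis measurable_realfun.
From mathcomp Require Import ring lra.

Set Implicit Arguments.
Unset Strict Implicit.
Unset Printing Implicit Defensive.

Import Order.TTheory GRing.Theory Num.Theory.
Import numFieldNormedType.Exports.

Local Open Scope classical_set_scope.
Local Open Scope ring_scope.

(** * Cardinals and volume of unions of grid cubes *)

(** Densities are measured in Euclidean balls, which a linear map turns into ellipsoids. For an
    arbitrary set of vectors the upper or lower density may depend on the shape of the window, so it
    has no reason to change by a constant factor. For a periodic set the shape is irrelevant
    ([has_density] quantifies over all star bodies), and this is why packings and coverings are made
    periodic before a linear map is applied. Lattices are periodic from the start. Let [A] be the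
    linear part of [sigma] and [A' = r^-1 A]. The two inclusions play separate roles. The second one
    puts a translate of [K0 A'] inside [K], and this single fact transports both the packings and
    the coverings. The first one is used only for the inequality vol(K) <= r^n vol(K0 A'), which is
    the origin of the factor. The infimum in the metric is not shown to be attained: the inequality
    is proved for every admissible [r], and the infimum is reached by a limit. *)

(* An infinite set has [ncard] 0. *)
Definition ncard (T : choiceType) (A : set T) : nat := #|` fset_set A|%fset.

Lemma ncard_sub (T : choiceType) (A B : set T) :
  finite_set B -> A `<=` B -> (ncard A <= ncard B)%N.
Proof.
move=> fB AB; apply: fsubset_leq_card.
by rewrite -fset_set_sub//; exact: sub_finite_set AB fB.
Qed.

Lemma ncard_image (T U : choiceType) (f : T -> U) (A : set T) :
  finite_set A -> {in A &, injective f} -> ncard (f @` A) = ncard A.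
Proof.
move=> fA fi; rewrite /ncard fset_set_image// card_in_imfset//= => x y.
by rewrite !in_fset_set// => xA yA; exact: fi.
Qed.

Lemma finite_inj (T U : choiceType) (f : T -> U) (A : set T) (B : set U) :
  finite_set B -> (forall x, A x -> B (f x)) -> {in A &, injective f} ->
  finite_set A.
Proof.
move=> fB fAB fi.
have : finite_set (f @` A) by apply: sub_finite_set fB => _ [x Ax <-]; exact: fAB.
by rewrite (eq_finite_set (inj_card_eq fi)).
Qed.

Lemma ncard_inj (T U : choiceType) (f : T -> U) (A : set T) (B : set U) :
  finite_set B -> (forall x, A x -> B (f x)) -> {in A &, injective f} ->
  (ncard A <= ncard B)%N.
Proof.
move=> fB fAB fi; rewrite -(ncard_image (finite_inj fB fAB fi) fi).
by apply: ncard_sub => // _ [x Ax <-]; exact: fAB.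
Qed.

(** Double counting of the pairs [(x, b)] with [f x = b]: each [x] with [f x] in [B] is seen by
    exactly one [b]. *)
Lemma ncard_fiber (T U : choiceType) (f : T -> U) (A : set T) (B : set U) :
  finite_set A -> finite_set B ->
  ncard (A `&` f @^-1` B) =
  (\sum_(b <- fset_set B) ncard (A `&` f @^-1` [set b]))%N.
Proof.
move=> fA fB; pose S := fset_set A.
have E (P : set U) : ncard (A `&` f @^-1` P) = \sum_(x <- S | f x \in P) 1%N.
  rewrite sum1_count -size_filter /ncard.
  rewrite (_ : fset_set _ = [fset x in [seq x <- S | f x \in P]]%fset).
    by rewrite card_fseq undup_id// filter_uniq// fset_uniq.
  apply/fsetP => x; rewrite in_fset_set; last exact: finite_setIl.
  rewrite !inE/= mem_filter in_fset_set// andbC.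
  by rewrite in_setI; congr (_ && _); apply/idP/idP; rewrite !inE.
rewrite E (eq_bigr _ (fun b _ => E [set b])) big_mkcond/=.
under [RHS]eq_bigr do rewrite big_mkcond/=.
rewrite exchange_big/=; apply: eq_bigr => x _.
case: ifPn => [|/negP] fxB.
  have fxB' : f x \in fset_set B by rewrite in_fset_set.
  rewrite (big_fsetD1 (f x))//= big1_seq ?addn0 ?ifT//; first exact/mem_set.
  move=> b /andP[_]; rewrite !inE => /andP[bf _]; rewrite ifF//.
  by apply/negbTE/negP => /set_mem /= fb; move: bf; rewrite fb eqxx.
rewrite big1_seq// => b /andP[_ bB]; rewrite ifF//; apply/negbTE/negP => /set_mem /= fb.
by apply: fxB; rewrite fb -(in_fset_set fB).
Qed.

(** With [ncard_fiber_ge], the form in which the later counts are made: [f] sends a point to the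
    index of its grid cell or of its period. *)
Lemma ncard_fiber_le (T U : choiceType) (f : T -> U) (A : set T) (B : set U) k :
  finite_set A -> finite_set B -> (forall x, A x -> B (f x)) ->
  (forall b, B b -> ncard (A `&` f @^-1` [set b]) <= k)%N ->
  (ncard A <= ncard B * k)%N.
Proof.
move=> fA fB fAB h.
have -> : A = A `&` f @^-1` B by apply/esym/setIidPl => x /fAB.
rewrite ncard_fiber// (@leq_trans (\sum_(b <- fset_set B) k)%N)//.
  by rewrite big_seq [leqRHS]big_seq leq_sum// => b; rewrite in_fset_set// => /set_mem /h.
by rewrite big_const_seq count_predT iter_addn_0 mulnC.
Qed.

Lemma ncard_fiber_ge (T U : choiceType) (f : T -> U) (A : set T) (B : set U) k :
  finite_set A -> finite_set B ->
  (forall b, B b -> k <= ncard (A `&` f @^-1` [set b]))%N ->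
  (ncard B * k <= ncard A)%N.
Proof.
move=> fA fB h.
apply: (@leq_trans (ncard (A `&` f @^-1` B))); last by apply: ncard_sub.
rewrite ncard_fiber// (@leq_trans (\sum_(b <- fset_set B) k)%N)//.
  by rewrite big_const_seq count_predT iter_addn_0 mulnC.
by rewrite big_seq [leqRHS]big_seq leq_sum// => b; rewrite in_fset_set// => /set_mem /h.
Qed.

Lemma volume_ge0 (R : realType) n (A : set 'rV[R]_n) : (0 <= volume A)%E.
Proof.
case: n A => [|n] A /=; first by rewrite lee_fin.
elim: n A => [|n IH] A; first by apply: integral_ge0 => x _; rewrite lee_fin.
by apply: integral_ge0 => x _; exact: IH.
Qed.

(* No measurability is needed: the integral of a nonnegative function is the
   supremum of the integrals of the simple functions below it. *)
Lemma integral_mono (R : realType) (f g : R -> \bar R) :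
  (forall x, 0 <= f x)%E -> (forall x, f x <= g x)%E ->
  (\int[@lebesgue_measure R]_x f x <= \int[@lebesgue_measure R]_x g x)%E.
Proof.
move=> f0 fg; have g0 x : (0 <= g x)%E by exact: le_trans (f0 x) (fg x).
rewrite !ge0_integralTE//; apply: ereal_sup_le => _ [h hf <-].
by exists h => // x; exact: le_trans (hf x) (fg x).
Qed.

Lemma volume_mono (R : realType) n (A B : set 'rV[R]_n) :
  A `<=` B -> (volume A <= volume B)%E.
Proof.
elim: n A B => [|n IH] A B AB /=.
  by rewrite lee_fin !indicE ler_nat; case: (boolP (0 \in A)) => // /set_mem/AB/mem_set->.
apply: integral_mono => x; first exact: volume_ge0.
by apply: IH => v; exact: AB.
Qed.

Definition latpt (R : realType) n (z : 'rV[int]_n) : 'rV[R]_n := map_mx intr z.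

Definition vfloor (R : realType) n (v : 'rV[R]_n) : 'rV[int]_n :=
  map_mx Num.floor v.

Lemma row_mx_headK (T : pzRingType) n (z : 'rV[T]_(1 + n)) :
  row_mx (z ord0 ord0)%:M (rsubmx z) = z.
Proof.
rewrite -[RHS]hsubmxK; congr row_mx; apply/rowP => i.
by rewrite !mxE (ord1 i) eqxx mulr1n; congr (z _ _); exact/val_inj.
Qed.

Lemma row_mx_head (T : pzRingType) n (a : T) (v : 'rV[T]_n) :
  (row_mx (a%:M : 'rV_1) v : 'rV[T]_(1 + n)) ord0 ord0 = a.
Proof.
have -> : (ord0 : 'I_(1 + n)) = lshift n ord0 by exact/val_inj.
by rewrite row_mxEl mxE eqxx mulr1n.
Qed.

(** Induction on the dimension by slicing along the first coordinate. The slice at [x] is a union of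
    cubes one dimension lower, indexed by the tails of those [z] in [Z] whose head is
    [floor (x / m)], so the integrand is a finite sum of multiples of indicators of half-open
    intervals of length [m]. *)
Lemma volume_cubes (R : realType) n (m : R) (Z : seq 'rV[int]_n) :
  0 < m -> uniq Z ->
  volume [set v : 'rV[R]_n | vfloor (m^-1 *: v) \in Z] = (m ^+ n * (size Z)%:R)%:E.
Proof.
move=> m0; elim: n Z => [|n IH] Z uZ.
  rewrite /= expr0 mul1r indicE; congr (_%:R%:E).
  have Zz z : z = 0 :> 'rV[int]_0 by apply/rowP => -[].
  rewrite (_ : (_ \in _) = (0 \in Z)); last first.
    apply/idP/idP => [/set_mem/=|h]; first by rewrite [vfloor _]Zz.
    by apply/mem_set => /=; rewrite [vfloor _]Zz.
  case: Z uZ => [//|a [|b s]] /=; first by rewrite (Zz a) inE eqxx.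
  by rewrite (Zz a) (Zz b) inE eqxx.
rewrite /=.
pose h (z : 'rV[int]_n.+1) (x : R) := ((m ^+ n)%:E *
  (\1_[set x : R | Num.floor (m^-1 * x) = z ord0 ord0] x)%:E)%E.
have mI k : [set x : R | Num.floor (m^-1 * x) = k] =
    [set` `[m * k%:~R, m * (k + 1)%:~R[].
  apply/seteqP; split => x /=; rewrite in_itv/=.
    move=> <-; rewrite -ler_pdivlMl// -ltr_pdivrMl// floor_le/=.
    exact: floorD1_gt.
  rewrite -ler_pdivlMl// -ltr_pdivrMl// => /andP[h1 h2].
  by apply/eqP; rewrite floor_eq h1.
have -> : (fun x => volume [set v : 'rV[R]_n |
     vfloor (m^-1 *: row_mx (x%:M : 'rV[R]_1) v) \in Z]) =
   (fun x => \sum_(z <- Z) h z x)%E.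
  apply/funext => x.
  pose k := Num.floor (m^-1 * x).
  pose Zk := [seq @rsubmx int 1 1 n z | z : 'rV[int]_n.+1 <- Z & z ord0 ord0 == k].
  rewrite (_ : [set v | _] = [set v | vfloor (m^-1 *: v) \in Zk]); last first.
    have E v : vfloor (m^-1 *: row_mx (x%:M : 'rV[R]_1) v) =
       row_mx (k%:M : 'rV[int]_1) (vfloor (m^-1 *: v)) :> 'rV_(1 + n).
      rewrite scale_row_mx /vfloor map_row_mx; congr row_mx.
      by apply/rowP => i; rewrite !mxE !ord1 eqxx !mulr1n.
    apply/seteqP; split => v /=; rewrite E.
      move=> h1; apply/mapP.
      exists (row_mx k%:M (vfloor (m^-1 *: v)) : 'rV_(1 + n)); last by rewrite row_mxKr.
      by rewrite mem_filter h1 andbT row_mx_head eqxx.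
    move=> /mapP[z]; rewrite mem_filter => /andP[/eqP zk zZ] ->.
    by rewrite -zk (row_mx_headK (z : 'rV[int]_(1 + n))).
  (* Vectors with the same head are told apart by their tails, so [Zk] has no duplicates. *)
  rewrite IH; last first.
    rewrite map_inj_in_uniq ?filter_uniq// => z z'.
    rewrite !mem_filter => /andP[/eqP zk _] /andP[/eqP zk' _] zz.
    rewrite -(row_mx_headK (z : 'rV[int]_(1 + n))).
    by rewrite -[RHS](row_mx_headK (z' : 'rV[int]_(1 + n))) zk zk' zz.
  rewrite size_map size_filter -sum1_count natr_sum big_distrr/= -sumEFin big_mkcond/=.
  apply: eq_bigr => z _; rewrite /h indicE.
  by case: eqP => zk; [rewrite mem_set//= mule1 mulr1|rewrite memNset/= ?mule0//; exact: nesym].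
rewrite ge0_integral_sum//; last 2 first.
  move=> z; apply: measurable_funeM; apply/measurable_EFinP.
  by apply: measurable_indic; rewrite mI.
  by move=> z x _; rewrite /h -EFinM lee_fin mulr_ge0// exprn_ge0// ltW.
transitivity (\sum_(z <- Z) (m ^+ n.+1)%:E)%E; last first.
  rewrite sumEFin; congr EFin.
  by rewrite big_const_seq count_predT iter_addr_0 mulr_natr.
apply: eq_bigr => z _; rewrite /h ge0_integralZl_EFin//; last 2 first.
  by apply/measurable_EFinP; apply: measurable_indic; rewrite mI.
  by rewrite exprn_ge0// ltW.
rewrite integral_indic ?setIT; last 2 first.
- exact: measurableT.
- by rewrite mI.
rewrite mI [X in (_ * X)%E]lebesgue_measure_itv/= lte_fin ltr_pM2l// ltr_int ltzD1 lexx.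
by rewrite -EFinB -EFinM -mulrBr rmorphD/= addrAC subrr add0r mulr1 exprSr.
Qed.

(** * Lattice points and the sup norm *)

Lemma expr1D_le (R : realFieldType) (k : nat) (x : R) : 0 <= x <= 1 ->
  (1 + x) ^+ k <= 1 + 3 ^+ k * x.
Proof.
move=> /andP[x0 x1]; elim: k => [|k IH]; first by rewrite !expr0 mul1r lerDl.
have a1 : (1 : R) <= 3 ^+ k by rewrite exprn_ege1// ler1n.
rewrite exprSr (le_trans (ler_wpM2r _ IH)) ?addr_ge0// exprSr.
move: (3 ^+ k) a1 => a a1.
(* (1 + a x)(1 + x) <= 1 + (2 a + 1) x <= 1 + 3 a x, because x <= 1 <= a. *)
have h1 : 0 <= (a - 1) * x by rewrite mulr_ge0//; lra.
have h2 : 0 <= a * x * (1 - x) by rewrite !mulr_ge0//; lra.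
nra.
Qed.

Lemma expr1B_ge (R : realFieldType) (k : nat) (x : R) : 0 <= x <= 1 ->
  1 - k%:R * x <= (1 - x) ^+ k.
Proof.
move=> /andP[x0 x1]; elim: k => [|k IH]; first by rewrite expr0 mul0r subr0.
rewrite exprSr (le_trans _ (ler_wpM2r _ IH)) ?subr_ge0// -natr1.
have : (0 : R) <= k%:R by [].
move: (k%:R) => a a0.
have h1 : 0 <= a * x * x by rewrite !mulr_ge0.
nra.
Qed.

(** Changing a large radius by a fixed [c] costs only a factor close to 1; the boundary layers and
    paddings below are absorbed in this way. *)
Lemma expr_shift (R : realFieldType) (k : nat) (c e : R) : 0 <= c -> 0 < e ->
  exists R0, [/\ 0 < R0, c < R0 & forall r, R0 <= r ->
   (r + c) ^+ k <= (1 + e) * r ^+ k /\ (1 - e) * r ^+ k <= (r - c) ^+ k].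
Proof.
move=> c0 e0; pose a : R := 3 ^+ k + k%:R + 1.
have p3 : (0 : R) < 3 ^+ k by rewrite exprn_gt0.
have a0 : 0 < a by rewrite /a; have : (0 : R) <= k%:R by []; lra.
have ca0 : 0 <= c * a / e by rewrite divr_ge0 ?mulr_ge0 // ltW.
(* The term [c * a / e] makes [a * (c / r) <= e], where [a] dominates both [3 ^+ k] and [k%:R]; the
   rest makes [c < r], so that [c / r] lies in [0, 1]. *)
exists (c * a / e + c + 1); split; [lra|lra|move=> r hr].
have r0 : 0 < r by lra.
have x01 : 0 <= c / r <= 1.
  by rewrite (divr_ge0 c0 (ltW r0))/= ler_pdivrMr// mul1r; lra.
have xe : a * (c / r) <= e.
  have : c * a / e <= r by lra.
  by rewrite ler_pdivrMr// mulrA ler_pdivrMr// mulrC [r * e]mulrC.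
have rk : 0 <= r ^+ k by rewrite exprn_ge0 ?ltW.
have k0 : (0 : R) <= k%:R by [].
move: (x01) => /andP[x0 _].
split.
  rewrite (_ : r + c = (1 + c / r) * r); last by field; rewrite gt_eqF.
  rewrite exprMn ler_wpM2r// (le_trans (expr1D_le _ x01))// lerD2l (le_trans _ xe)//.
  by rewrite ler_wpM2r// /a -addrA lerDl addr_ge0.
rewrite (_ : r - c = (1 - c / r) * r); last by field; rewrite gt_eqF.
rewrite exprMn ler_wpM2r// (le_trans _ (expr1B_ge _ x01))// lerD2l lerN2.
by rewrite (le_trans _ xe)// ler_wpM2r// /a -addrA addrCA lerDl addr_ge0// ltW.
Qed.

(** Continuity of the power at 1, taken from [expr_shift] with [c := 1]: for e = 1/R0, (1 + e)^k =
    (R0 + 1)^k / R0^k. *)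
Lemma le_expr1D_lim (R : realFieldType) (k : nat) (x A : R) : 0 <= A ->
  (forall e, 0 < e -> x <= A * (1 + e) ^+ k) -> x <= A.
Proof.
move=> A0 h; apply/ler_addgt0Pr => e e0.
have d0 : 0 < e / (A + 1) by rewrite divr_gt0//; lra.
have [R0 [R00 _ hR]] := expr_shift k ler01 d0.
have := h _ (_ : 0 < R0^-1); rewrite invr_gt0 => /(_ R00).
have [hR1 _] := hR _ (lexx _).
have E : (1 + R0^-1) ^+ k <= 1 + e / (A + 1).
  rewrite -(ler_pM2r (_ : 0 < R0 ^+ k)) ?exprn_gt0// -exprMn mulrDl mul1r.
  by rewrite mulVf ?gt_eqF.
move=> /le_trans; apply; rewrite (le_trans (ler_wpM2l A0 E))// mulrDr mulr1 lerD2l.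
rewrite mulrCA ler_piMr ?(ltW e0)//.
by rewrite ler_pdivrMr; lra.
Qed.

Section sup_norm.
Variables (R : realType) (n : nat).
Implicit Types (v w t u : 'rV[R]_n) (m r : R) (z : 'rV[int]_n).

Lemma norm_coord v i : `|v ord0 i| <= `|v|.
Proof.
by rewrite [leRHS]/Num.Def.normr /= mx_normrE; apply/bigmax_geP; right => /=; exists (ord0, i).
Qed.

Lemma row_norm_le v r : 0 <= r -> (forall i, `|v ord0 i| <= r) -> `|v| <= r.
Proof.
move=> r0 h; rewrite [leLHS]/Num.Def.normr /= mx_normrE.
by apply: bigmax_le => // -[i j] _ /=; rewrite ord1.
Qed.

Lemma vfloor_norm v : `|v - latpt R (vfloor v)| <= 1.
Proof.
apply: row_norm_le => // i; rewrite !mxE ler_norml; apply/andP; split.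
  by rewrite (@le_trans _ _ 0)// ?lerN10// subr_ge0 floor_le.
by rewrite lerBlDl ltW// -intrD1 floorD1_gt.
Qed.

Lemma vfloorD z v : vfloor (latpt R z + v) = z + vfloor v.
Proof. by apply/rowP => i; rewrite !mxE floorDzr// intrKfloor. Qed.

Lemma vfloor_dist v w i : vfloor v = vfloor w -> `|v ord0 i - w ord0 i| < 1.
Proof.
move=> /rowP/(_ i); rewrite !mxE => E.
have := floor_le (v ord0 i); have := floorD1_gt (v ord0 i).
have := floor_le (w ord0 i); have := floorD1_gt (w ord0 i).
rewrite E intrD; set k := _%:~R; move=> *; rewrite ltr_norml; lra.
Qed.

Lemma latptD z z' : latpt R (z + z') = latpt R z + latpt R z'.
Proof. by rewrite /latpt map_mxD. Qed.

Definition bdd (W : set 'rV[R]_n) := exists C, forall w, W w -> `|w| <= C.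

(** A relation rather than an operation: typically [W'] is a larger dilate of the same body, whose
    volume is under control, unlike that of the exact neighbourhood [fat m W]. *)
Definition thick m (W W' : set 'rV[R]_n) :=
  forall w u, W w -> `|u| <= m -> W' (w + u).

Definition fat m (W : set 'rV[R]_n) := [set v | exists2 w, W w & `|v - w| <= m].

Lemma thick_fat m W : thick m W (fat m W).
Proof. by move=> w u Ww hu; exists w => //; rewrite addrC addKr. Qed.

Lemma bdd_fat m W : bdd W -> bdd (fat m W).
Proof.
move=> [C hC]; exists (C + m) => v [w /hC wC vw].
by rewrite -(subrK w v) addrC (le_trans (ler_normD _ _)) ?lerD.
Qed.

Lemma bdd_sub (W W' : set 'rV[R]_n) : W `<=` W' -> bdd W' -> bdd W.
Proof. by move=> s [C h]; exists C => w /s/h. Qed.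

Lemma bdd_affine r t W : bdd W -> bdd (translate t (dilate r W)).
Proof.
move=> [C h]; exists (`|r| * C + `|t|) => _ [_ [w /h hw <-] <-].
by rewrite (le_trans (ler_normD _ _))// lerD2r normrZ ler_wpM2l.
Qed.

Lemma finite_latpt C : finite_set [set z : 'rV[int]_n | `|latpt R z| <= C].
Proof.
pose N := Num.bound `|C|.
pose f (a : 'rV['I_(N.*2.+1)]_n) : 'rV[int]_n := map_mx (fun k : 'I__ => k%:Z - N%:Z) a.
apply: (@sub_finite_set _ _ (f @` setT)); last by apply: finite_image; exact: finite_finset.
move=> z /= hz.
have hi i : `|z ord0 i| <= N%:Z.
  rewrite -(ler_int R) intr_norm -pmulrn.
  have := norm_coord (latpt R z) i; rewrite mxE => /le_trans; apply.
  apply: (le_trans hz); rewrite (le_trans (ler_norm _))//.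
  exact/ltW/archi_boundP.
exists (\row_(i < n) inord (absz (z ord0 i + N%:Z))) => //.
apply/rowP => i; have := hi i; rewrite ler_norml => /andP[h1 h2].
have h0 : 0 <= z ord0 i + N%:Z by rewrite -lerBlDr sub0r.
rewrite !mxE inordK; first by rewrite gez0_abs// addrK.
by rewrite ltnS -lez_nat gez0_abs// -addnn PoszD lerD2r.
Qed.

Definition cnt m (W : set 'rV[R]_n) := ncard [set z | W (m *: latpt R z)].

Lemma finite_cnt m W : 0 < m -> bdd W -> finite_set [set z | W (m *: latpt R z)].
Proof.
move=> m0 [C h]; apply: sub_finite_set (finite_latpt (C / m)) => z /h.
by rewrite normrZ gtr0_norm// mulrC -ler_pdivlMr.
Qed.

Lemma vfloor_scale_norm m v : 0 < m -> `|v - m *: latpt R (vfloor (m^-1 *: v))| <= m.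
Proof.
move=> m0; rewrite (_ : v - _ = m *: (m^-1 *: v - latpt R (vfloor (m^-1 *: v)))).
  by rewrite normrZ gtr0_norm// -[leRHS]mulr1 ler_wpM2l ?(ltW m0)// vfloor_norm.
by rewrite scalerBr scalerA divff ?gt_eqF// scale1r.
Qed.

(** The half-open cubes of side [m] with lower corner in [W] are disjoint and lie in [W'].
    Conversely, in [volume_le_cnt], each point of [W] lies in a cube whose corner belongs to
    [W']. *)
Lemma cnt_le_volume m W W' : 0 < m -> bdd W -> thick m W W' ->
  ((m ^+ n * (cnt m W)%:R)%:E <= volume W')%E.
Proof.
move=> m0 bW hW; have fW := finite_cnt m0 bW.
rewrite -volume_cubes ?fset_uniq//; apply: volume_mono => v /=.
rewrite in_fset_set// => /set_mem /= Wv.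
by have := hW _ _ Wv (vfloor_scale_norm v m0); rewrite addrC subrK.
Qed.

Lemma volume_le_cnt m W W' : 0 < m -> bdd W' -> thick m W W' ->
  (volume W <= (m ^+ n * (cnt m W')%:R)%:E)%E.
Proof.
move=> m0 bW hW; have fW := finite_cnt m0 bW.
rewrite -volume_cubes ?fset_uniq//; apply: volume_mono => v /= Wv.
rewrite in_fset_set//; apply/mem_set => /=.
rewrite (_ : _ *: _ = v + - (v - m *: latpt R (vfloor (m^-1 *: v)))).
  by apply: hW => //; rewrite normrN vfloor_scale_norm.
by rewrite opprB addrC subrK.
Qed.

Lemma volume_fin W : bdd W -> volume W \is a fin_num.
Proof.
move=> bW; rewrite ge0_fin_numE ?volume_ge0//.
by rewrite (le_lt_trans (volume_le_cnt ltr01 (bdd_fat 1 bW) (@thick_fat _ _))) ?ltry.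
Qed.

(** The image is counted on a grid of mesh [m = r * mu], and [W] on one of mesh [mu]. Shifting
    indices by [k], the cell of [t], and dividing by [r] turns a grid point within [m] of the image
    into one within [2 * mu] of [W]: one [mu] for that distance, one for the rounding of [t]. A
    third [mu] is the side of the cubes in [cnt_le_volume], hence [mu = d / 3]. *)
Lemma volume_affine_le W W' d r t : bdd W -> 0 < d -> thick d W W' -> 0 < r ->
  (volume (translate t (dilate r W)) <= (r ^+ n)%:E * volume W')%E.
Proof.
move=> bW d0 hW r0; pose mu := d / 3; pose m := r * mu.
have mu0 : 0 < mu by rewrite /mu; lra.
have m0 : 0 < m by rewrite mulr_gt0.
have bV := bdd_fat m (bdd_affine r t bW).
apply: (le_trans (volume_le_cnt m0 bV (@thick_fat _ _))).
have bW2 := bdd_fat (2 * mu) bW.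
apply: (@le_trans _ _ ((r ^+ n)%:E * (mu ^+ n * (cnt mu (fat (2 * mu) W))%:R)%:E)%E).
  rewrite -EFinM lee_fin exprMn -mulrA !ler_wpM2l ?exprn_ge0 ?(ltW r0) ?(ltW mu0)// ler_nat.
  pose k := vfloor (m^-1 *: t).
  apply: (@ncard_inj _ _ (fun z => z - k)); first exact: finite_cnt.
    move=> z /= [_ [_ [w Ww <-] <-] hz]; exists w => //.
    rewrite (_ : mu *: _ - w = r^-1 *: ((m *: latpt R z - (r *: w + t))
        + (t - m *: latpt R k))); last first.
      apply/rowP => i; rewrite !mxE rmorphB /m /=; field.
      by rewrite gt_eqF.
    rewrite normrZ gtr0_norm ?invr_gt0// mulrC ler_pdivrMr//.
    rewrite (le_trans (ler_normD _ _))// (_ : 2 * mu * r = m + m); last by rewrite /m; lra.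
    by rewrite lerD// vfloor_scale_norm.
  by move=> z z' _ _ /addIr.
rewrite lee_wpmul2l ?lee_fin ?exprn_ge0 ?(ltW r0)//.
apply: cnt_le_volume => // v u [w Ww hv] hu.
rewrite (_ : v + u = w + (v - w + u)); last by rewrite addrA [w + _]addrC subrK.
apply: hW => //; rewrite (le_trans (ler_normD _ _))//.
by rewrite (le_trans (lerD hv hu))// /mu; lra.
Qed.

End sup_norm.

(** * Star bodies and homogeneity of the volume *)

Section star_bodies.
Variables (R : realType) (n : nat).
Implicit Types (v w t u : 'rV[R]_n) (m r : R) (S : set 'rV[R]_n).

Lemma dilateM r r' S : dilate r (dilate r' S) = dilate (r * r') S.
Proof.
apply/seteqP; split => [_ [_ [s Ss <-] <-]|_ [s Ss <-]].
  by exists s => //; rewrite scalerA.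
by exists (r' *: s); [exists s|rewrite scalerA].
Qed.

Lemma dilate1 S : dilate 1 S = S.
Proof.
apply/seteqP; split => [_ [s Ss <-]|s Ss]; first by rewrite scale1r.
by exists s => //; rewrite scale1r.
Qed.

Lemma translate0 S : translate 0 S = S.
Proof.
apply/seteqP; split => [_ [s Ss <-]|s Ss]; first by rewrite addr0.
by exists s => //; rewrite addr0.
Qed.

Lemma translateD t t' S : translate t (translate t' S) = translate (t' + t) S.
Proof.
apply/seteqP; split => [_ [_ [s Ss <-] <-]|_ [s Ss <-]].
  by exists s => //; rewrite addrA.
by exists (s + t'); [exists s|rewrite addrA].
Qed.

Lemma dilate_translate r t S :
  dilate r (translate t S) = translate (r *: t) (dilate r S).
Proof.
apply/seteqP; split => [_ [_ [s Ss <-] <-]|_ [_ [s Ss <-] <-]].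
  by exists (r *: s); [exists s|rewrite scalerDr].
by exists (s + t); [exists s|rewrite scalerDr].
Qed.

Lemma bdd_dilate r S : bdd S -> bdd (dilate r S).
Proof. by move=> /(bdd_affine r 0); rewrite translate0. Qed.

Lemma thick_translate m t S S' : thick m S S' -> thick m (translate t S) (translate t S').
Proof.
by move=> h _ u [s Ss <-] hu; exists (s + u); [exact: h|rewrite addrAC].
Qed.

(* Satisfied by the bounded convex sets having the origin in their interior. *)
Definition star S := [/\ bdd S, S !=set0 &
  exists2 c, 0 < c &
  forall r m, 0 < r -> 0 <= m -> thick m (dilate r S) (dilate (r + c * m) S)].

Definition vol S : R := fine (volume S).

Lemma volE S : bdd S -> volume S = (vol S)%:E.
Proof. by move=> /volume_fin/fineK. Qed.

Lemma vol_ge0 S : 0 <= vol S.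
Proof. by rewrite fine_ge0// volume_ge0. Qed.

Lemma vol_mono S S' : bdd S' -> S `<=` S' -> vol S <= vol S'.
Proof.
move=> bS' sSS'; have bS := bdd_sub sSS' bS'.
by rewrite -lee_fin -!volE//; exact: volume_mono.
Qed.

Lemma vol_affine_le W W' d r t : bdd W -> bdd W' -> 0 < d -> thick d W W' -> 0 < r ->
  vol (translate t (dilate r W)) <= r ^+ n * vol W'.
Proof.
move=> bW bW' d0 hW r0.
rewrite -lee_fin EFinM -!volE//; last exact: bdd_affine.
exact: volume_affine_le bW d0 hW r0.
Qed.

(* [volume_affine_le] applied to the map and to its inverse; [cont] removes the
   enlargement of the set. *)
Lemma vol_affine S r t : star S -> 0 < r ->
  vol (translate t (dilate r S)) = r ^+ n * vol S.
Proof.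
move=> [bS _ [c c0 hS]].
have up s e x y : 0 < x -> 0 < s -> 0 < e ->
    vol (translate y (dilate (x * s) S)) <= x ^+ n * vol (dilate (s * (1 + e)) S).
  move=> x0 s0 e0; rewrite -dilateM.
  have d0 : 0 < s * e / c by rewrite divr_gt0// mulr_gt0.
  apply: (@vol_affine_le _ _ (s * e / c)) => //; [exact: bdd_dilate|exact: bdd_dilate|].
  have -> : s * (1 + e) = s + c * (s * e / c) by field; rewrite gt_eqF.
  by apply: hS => //; exact: ltW.
have cont e : 0 < e -> vol (dilate (1 + e) S) <= (1 + e) ^+ (2 * n) * vol S.
  move=> e0; have e1 : 0 < 1 + e by lra.
  (* With s = 1/(1 + e) and x = (1 + e)^2, the left side has ratio x s = 1 + e and the right side s
     (1 + e) = 1; hence the exponent [2 * n]. *)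
  have := up (1 + e)^-1 e ((1 + e) ^+ 2) 0.
  rewrite exprn_gt0// invr_gt0 e1 mulVf ?gt_eqF// expr2 mulfK ?gt_eqF//.
  by rewrite translate0 dilate1 -expr2 -exprM => ->.
move=> r0; have rn0 : 0 < r ^+ n by rewrite exprn_gt0.
apply/le_anti/andP; split.
  apply: (@le_expr1D_lim _ (2 * n)); first by rewrite mulr_ge0 ?vol_ge0// ltW.
  move=> e e0; have := up 1 e r t r0 ltr01 e0; rewrite mulr1 mul1r => /le_trans; apply.
  by rewrite -mulrA ler_wpM2l ?(ltW rn0)// mulrC cont.
apply: (@le_expr1D_lim _ n); first exact: vol_ge0.
move=> e e0; have e1 : 0 < 1 + e by lra.
(* For the reverse inequality the inverse map is applied to the smaller image of ratio [x], whose
   enlargement still lies in the image of ratio [r]. *)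
pose x := r / (1 + e); have x0 : 0 < x by rewrite divr_gt0.
have : vol (translate (- (x^-1 *: t)) (dilate x^-1 (translate t (dilate x S)))) <=
   x^-1 ^+ n * vol (translate t (dilate r S)).
  have d0 : 0 < x * e / c by rewrite divr_gt0// mulr_gt0.
  apply: (@vol_affine_le _ _ (x * e / c)); rewrite ?invr_gt0//; try exact: bdd_affine.
  have -> : r = x + c * (x * e / c) by rewrite /x; field; rewrite !gt_eqF.
  by apply: thick_translate; apply: hS => //; exact: ltW.
rewrite dilate_translate translateD subrr translate0 dilateM mulVf ?gt_eqF// dilate1.
rewrite exprVn mulrC ler_pdivlMr ?exprn_gt0// /x expr_div_n mulrA ler_pdivrMr ?exprn_gt0//.
by rewrite [vol S * _]mulrC.
Qed.

Lemma vol_dilate S r : star S -> 0 < r -> vol (dilate r S) = r ^+ n * vol S.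
Proof. by move=> sS r0; rewrite -(vol_affine 0 sS r0) translate0. Qed.

Lemma vol_translate S t : star S -> vol (translate t S) = vol S.
Proof.
by move=> sS; rewrite -[in LHS](dilate1 S) vol_affine// expr1n mul1r.
Qed.

(** [S] contains a grid cube of side [m]: half of a point [s] of [S] may be displaced by [2 * m]
    inside [S], by [m] to reach the grid and by [m] again for the cube. The equation
    [2^-1 + c * (2 * m) = 1] fixes [m]. *)
Lemma star_vol_gt0 S : star S -> 0 < vol S.
Proof.
move=> [bS [s Ss] [c c0 hS]].
pose m := (4 * c)^-1; have m0 : 0 < m by rewrite invr_gt0 mulr_gt0.
pose p := m *: latpt R (vfloor (m^-1 *: (2^-1 *: s))).
have : ((m ^+ n * (cnt m [set p])%:R)%:E <= volume S)%E.
  apply: cnt_le_volume => //; first by exists `|p| => _ ->.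
  move=> _ u -> hu.
  have h2 : 2^-1 + c * (2 * m) = 1 by rewrite /m; field; rewrite gt_eqF.
  have := hS 2^-1 (2 * m) _ _ (2^-1 *: s) (p + u - 2^-1 *: s).
  rewrite h2 dilate1 (_ : _ + (p + u - _) = p + u); last by rewrite addrC subrK.
  apply; rewrite ?invr_gt0//.
  - by rewrite mulr_ge0// ltW.
  - by exists s.
  rewrite addrAC (le_trans (ler_normD _ _))//.
  rewrite (_ : 2 * m = m + m); last by lra.
  by rewrite lerD// distrC vfloor_scale_norm.
rewrite volE// lee_fin; apply: lt_le_trans.
rewrite mulr_gt0 ?exprn_gt0// ltr0n /cnt /ncard cardfs_gt0.
apply/fset0Pn; exists (vfloor (m^-1 *: (2^-1 *: s))).
rewrite in_fset_set ?inE//.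
by apply: (@finite_cnt _ _ m [set p]) => //; exists `|p| => _ ->.
Qed.

Lemma star_dilate_sub S r r' : star S -> 0 < r -> r <= r' -> dilate r S `<=` dilate r' S.
Proof.
move=> [_ _ [c c0 hS]] r0 rr' v Sv.
have d0 : 0 <= (r' - r) / c by rewrite divr_ge0 ?subr_ge0// ltW.
have := hS r ((r' - r) / c) r0 d0 v 0 Sv.
by rewrite normr0 addr0 mulrCA divff ?gt_eqF// mulr1 [r + _]addrC subrK; exact.
Qed.

Lemma star_fat S : star S -> exists2 c, 0 < c & forall C r, 0 <= C -> c * C < r ->
  thick C (dilate r S) (dilate (r + c * C) S) /\
  thick C (dilate (r - c * C) S) (dilate r S).
Proof.
move=> [_ _ [c c0 hS]]; exists c => // C r C0 Cr; split.
  by apply: hS => //; rewrite (le_lt_trans _ Cr)// mulr_ge0// ltW.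
by have := @hS (r - c * C) C; rewrite subrK subr_gt0; exact.
Qed.

(** The constant is the inverse of the radius: with k = r + m/e, r s + u = k ((r/k) s + (1 - r/k)
    (e/m) u), a multiple of a convex combination of [s] and a point of norm at most [e]. *)
Lemma convex_star S e : bdd S -> 0 < e -> [set v | `|v| <= e] `<=` S ->
  (forall x y a, S x -> S y -> 0 <= a <= 1 -> S (a *: x + (1 - a) *: y)) ->
  star S.
Proof.
move=> bS e0 eS cS; split => //; first by exists 0; apply: eS; rewrite /= normr0 ltW.
exists e^-1; first by rewrite invr_gt0.
move=> r m r0 m0 _ u [s Ss <-] hu; pose k := r + e^-1 * m.
have em : 0 <= e^-1 * m by rewrite mulr_ge0// invr_ge0 ltW.
have k0 : 0 < k by rewrite /k; lra.
have ru : `|e / m *: u| <= e.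
  rewrite normrZ ger0_norm ?divr_ge0 ?(ltW e0)// -mulrA ler_piMr ?(ltW e0)//.
  have [->|mn0] := eqVneq m 0; first by rewrite invr0 mul0r.
  by rewrite mulrC ler_pdivrMr ?mul1r// lt_def mn0.
exists ((r / k) *: s + (1 - r / k) *: (e / m *: u)).
  apply: cS => //; first exact: eS.
  by rewrite divr_ge0 ?(ltW r0) ?(ltW k0)//= ler_pdivrMr// mul1r /k lerDl.
rewrite scalerDr !scalerA mulrCA divff ?gt_eqF// mulr1; congr (_ + _).
(* If [m = 0] then [u = 0], and [e / m] is 0 by the convention on inverses. *)
have [m00|mn0] := eqVneq m 0.
  by move: hu; rewrite m00 normr_le0 => /eqP ->; rewrite scaler0.
rewrite -[RHS]scale1r; congr (_ *: _); rewrite mulrBr mulr1 [k * (r / k)]mulrCA divff ?gt_eqF// mulr1.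
by rewrite /k addrC addKr; field; rewrite mn0 gt_eqF.
Qed.

Lemma mulmx_bound (A : 'M[R]_n) : exists2 C, 0 < C & forall v, `|v *m A| <= C * `|v|.
Proof.
pose C := 1 + \sum_i \sum_j `|A i j|.
have C0 : 0 <= \sum_i \sum_j `|A i j| by rewrite sumr_ge0// => i _; rewrite sumr_ge0.
exists C => [|v]; first by rewrite /C; lra.
apply: row_norm_le => [|j]; first by rewrite mulr_ge0// /C; lra.
rewrite mxE (le_trans (ler_norm_sum _ _ _))//.
rewrite (@le_trans _ _ (\sum_i `|v| * `|A i j|))//.
  by apply: ler_sum => i _; rewrite normrM ler_wpM2r// norm_coord.
rewrite -mulr_sumr mulrC ler_wpM2r// /C (@le_trans _ _ (\sum_i \sum_j `|A i j|)) ?lerDr//.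
by apply: ler_sum => i _; rewrite (bigD1 j)//= lerDl sumr_ge0.
Qed.

Definition lin (A : 'M[R]_n) S := [set y *m A | y in S].

Lemma lin_dilate (A : 'M[R]_n) r S : lin A (dilate r S) = dilate r (lin A S).
Proof.
apply/seteqP; split => [_ [_ [s Ss <-] <-]|_ [_ [s Ss <-] <-]].
  by exists (s *m A); [exists s|rewrite scalemxAl].
by exists (r *: s); [exists s|rewrite scalemxAl].
Qed.

Lemma star_lin (A : 'M[R]_n) S : A \in unitmx -> star S -> star (lin A S).
Proof.
move=> uA [[D hD] [s Ss] [c c0 hS]].
have [C C0 hC] := mulmx_bound A; have [C' C'0 hC'] := mulmx_bound (invmx A).
split.
- exists (C * D) => _ [y /hD hy <-].
  by rewrite (le_trans (hC _))// ler_wpM2l// ltW.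
- by exists (s *m A); exists s.
(* A displacement [u] of the image pulls back to [u *m invmx A], of norm at most [C' * m]. *)
exists (c * C'); first exact: mulr_gt0.
move=> r m r0 m0; rewrite -!lin_dilate => _ u [y Sy <-] hu.
have Cm : 0 <= C' * m by rewrite mulr_ge0// ltW.
exists (y + u *m invmx A); last by rewrite mulmxDl mulmxKV.
rewrite -mulrA; apply: (hS r (C' * m) r0 Cm) => //.
by rewrite (le_trans (hC' _))// ler_wpM2l// ltW.
Qed.

Lemma bdd_compact S : compact S -> bdd S.
Proof.
move=> /compact_bounded [M [_ hM]]; exists (M + 1) => w Sw.
by apply: (hM (M + 1)) => //; rewrite ltrDl.
Qed.

Lemma convex_setP S : convex_set S ->
  forall x y a, S x -> S y -> 0 <= a <= 1 -> S (a *: x + (1 - a) *: y).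
Proof.
move=> cS x y a Sx Sy ha.
have := cS x y (Itv01 (andP ha).1 (andP ha).2) (mem_set Sx) (mem_set Sy).
by move=> /set_mem.
Qed.

Lemma convex_body_star S : convex_body S ->
  exists t S', star S' /\ S = translate t S'.
Proof.
move=> [cS vS [k kS]].
have [/= e e0 he] := (nbhs_ballP _ _).1 kS.
exists k, (translate (- k) S); split.
  (* The ball of radius [e] inside [S] is open, while [convex_star] asks for a closed one. *)
  have e20 : 0 < e / 2 by rewrite divr_gt0.
  apply: (convex_star _ e20).
  - by rewrite -[S]dilate1; apply: bdd_affine; exact: bdd_compact.
  - move=> v /= hv; exists (k + v); last by rewrite addrAC subrr add0r.
    apply: he; rewrite -ball_normE /ball_/= opprD addrA subrr add0r normrN.
    by rewrite (le_lt_trans hv)// ltr_pdivrMr// ltr_pMr// ltr1n.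
  move=> _ _ a [x Sx <-] [y Sy <-] ha.
  exists (a *: x + (1 - a) *: y); first exact: convex_setP.
  by apply/rowP => i; rewrite !mxE; ring.
by rewrite translateD addNr translate0.
Qed.

Lemma star_unit_ball : star (@unit_ball R n).
Proof.
have E v : unit_ball v <-> \sum_(i < n) v ord0 i ^+ 2 <= 1.
  rewrite /unit_ball/= -[X in _ <= X <-> _]sqrtr1 ler_psqrt// nnegrE//.
  by rewrite sumr_ge0// => i _; rewrite sqr_ge0.
have n0 : (0 : R) < n.+1%:R by rewrite ltr0n.
(* Each of the [n] squares is then at most 1/(n+1), so their sum is at most 1, also for [n = 0]. *)
apply: (@convex_star _ n.+1%:R^-1); rewrite ?invr_gt0//.
- exists 1 => v /E hv; apply: row_norm_le => // i.
  rewrite -(ler_pXn2r (ltn0Sn 1)) ?nnegrE// expr1n real_normK ?num_real//.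
  by apply: le_trans hv; rewrite (bigD1 i)//= lerDl sumr_ge0// => j _; rewrite sqr_ge0.
- move=> v /= hv; apply/E.
  rewrite (@le_trans _ _ (\sum_(i < n) n.+1%:R^-1))//.
    apply: ler_sum => i _; rewrite -[_ ^+ 2]real_normK ?num_real//.
    have h : `|v ord0 i| <= n.+1%:R^-1 by rewrite (le_trans (norm_coord _ _)).
    rewrite expr2 (le_trans (ler_pM _ _ h h))// ler_piMr ?invr_ge0 ?(ltW n0)//.
    by rewrite invf_le1// ler1n.
  rewrite sumr_const card_ord -[leLHS]mulr_natl ler_pdivrMr// mul1r ler_nat.
  exact: leqnSn.
move=> x y a /E hx /E hy /andP[a0 a1]; apply/E.
rewrite (@le_trans _ _ (\sum_(i < n) (a * x ord0 i ^+ 2 + (1 - a) * y ord0 i ^+ 2)))//.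
  apply: ler_sum => i _; rewrite !mxE.
  move: (x _ _) (y _ _) => p q.
  have a1' : 0 <= 1 - a by rewrite subr_ge0.
  (* This is the exact gap in the convexity inequality of the square. *)
  have h : 0 <= a * (1 - a) * (p - q) ^+ 2 := mulr_ge0 (mulr_ge0 a0 a1') (sqr_ge0 _).
  by rewrite -subr_ge0 (le_trans h)// le_eqVlt; apply/orP; left; apply/eqP; ring.
rewrite big_split/= -!mulr_sumr.
have := ler_wpM2l a0 hx; have := ler_wpM2l (_ : 0 <= 1 - a) hy.
by rewrite subr_ge0 => /(_ a1); lra.
Qed.

End star_bodies.

(** * Density of periodic sets *)

Section lattice_point_counting.
Variables (R : realType) (n : nat).
Implicit Types (v w t u : 'rV[R]_n) (m r e : R) (S W X : set 'rV[R]_n).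
Implicit Types (A B : 'M[R]_n).

Definition locfin X := forall C, finite_set (X `&` [set x | `|x| <= C]).

Definition invariant B X := forall x z, X x -> X (x + latpt R z *m B).

Definition periodic_set X := locfin X /\ exists2 B, B \in unitmx & invariant B X.

Lemma locfin_bdd X W : locfin X -> bdd W -> finite_set (X `&` W).
Proof.
move=> fX [C hC]; apply: sub_finite_set (fX C) => x [Xx /hC xC]; split => //.
Qed.

(** The coordinates of [v] in the basis [B] are rounded; [C] bounds the covering radius of the
    lattice. *)
Lemma lattice_dense B : B \in unitmx ->
  exists2 C, 0 < C & forall v, exists z, `|v - latpt R z *m B| <= C.
Proof.
move=> uB; have [C C0 hC] := mulmx_bound B; exists C => // v.
exists (vfloor (v *m invmx B)); rewrite -{1}(mulmxKV uB v) -mulmxBl.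
by rewrite (le_trans (hC _))// ler_piMr ?vfloor_norm// ltW.
Qed.

(** The side is [2 * m], so that the tile is comparable with the centred cube of
    [cube_count X m]. *)
Definition tile m z := [set v : 'rV[R]_n | vfloor ((2 * m)^-1 *: v) = z].

Definition tile_center m z : 'rV[R]_n := (2 * m) *: latpt R z + const_mx m.

Lemma tile_norm m z v : 0 < m -> tile m z v -> `|v - tile_center m z| <= m.
Proof.
move=> m0 /rowP E; apply: row_norm_le => [|i]; first exact: ltW.
have m20 : 0 < 2 * m by lra.
have := E i; rewrite !mxE => Ei.
have := floor_le ((2 * m)^-1 * v ord0 i).
have := floorD1_gt ((2 * m)^-1 * v ord0 i); rewrite Ei.
rewrite ltr_pdivrMl// ler_pdivlMl// intrD => h1 h2.
by rewrite ler_norml; apply/andP; split; lra.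
Qed.

Lemma tile_near m z v : 0 < m -> `|v - tile_center m z| < m -> tile m z v.
Proof.
move=> m0 h; apply/rowP => i.
have m20 : 0 < 2 * m by lra.
have := le_lt_trans (norm_coord _ i) h; rewrite !mxE ltr_norml => /andP[h1 h2].
apply/eqP; rewrite floor_eq ler_pdivlMl// ltr_pdivrMl// intrD.
by apply/andP; split; lra.
Qed.

Definition cube_count X m := ncard (X `&` [set v | `|v| <= m]).

(** A vector of the period lattice brings the centre of the tile to within a fixed distance of the
    origin, so every tile has about as many points as the centred cube; the error in the size
    depends neither on [m] nor on [z]. *)
Lemma tile_count X : periodic_set X -> exists2 C, 0 < C & forall m z, 0 < m ->
  (cube_count X (m - C) <= ncard (X `&` tile m z))%N /\
  (ncard (X `&` tile m z) <= cube_count X (m + C))%N.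
Proof.
move=> [fX [B uB iX]]; have [C C0 hC] := lattice_dense uB.
(* The extra 1 gives the strict inequality required by [tile_near]. *)
exists (C + 1) => [|m z m0]; first lra.
have [k hk] := hC (tile_center m z).
have fT : finite_set (X `&` tile m z).
  apply: (@locfin_bdd _ (tile m z)) => //.
  exists (m + `|tile_center m z|) => v /(tile_norm m0) hv.
  by rewrite -[v](subrK (tile_center m z)) (le_trans (ler_normD _ _))// lerD2r.
split.
  apply: (@ncard_inj _ _ (fun x => x + latpt R k *m B)) => //.
    move=> x [Xx /= hx]; split; first exact: iX.
    apply: tile_near => //.
    rewrite -addrA (le_lt_trans (ler_normD _ _))// -[X in _ + X]normrN opprB.
    by rewrite (le_lt_trans (lerD hx hk))//; lra.
  by move=> x y _ _ /addIr.
apply: (@ncard_inj _ _ (fun x => x + latpt R (- k) *m B)).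
- exact: fX.
- move=> x [Xx hx]; split; first exact: iX.
  rewrite /= /latpt map_mxN mulNmx.
  rewrite (_ : x - _ = (x - tile_center m z) + (tile_center m z - latpt R k *m B)).
    rewrite (le_trans (ler_normD _ _))// (le_trans (lerD (tile_norm m0 hx) hk))//.
    by lra.
  by rewrite addrA subrK.
- by move=> x y _ _ /addIr.
Qed.

Lemma thick_tile m W W' v : 0 < m -> thick (2 * m) W W' -> W v ->
  W' ((2 * m) *: latpt R (vfloor ((2 * m)^-1 *: v))).
Proof.
move=> m0 hW Wv; have m20 : 0 < 2 * m by lra.
rewrite (_ : _ *: _ = v + - (v - (2 * m) *: latpt R (vfloor ((2 * m)^-1 *: v)))).
  by apply: hW => //; rewrite normrN vfloor_scale_norm.
by rewrite opprB addrC subrK.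
Qed.

Lemma thick_tile_sub m W W' z : 0 < m -> thick (2 * m) W W' ->
  W ((2 * m) *: latpt R z) -> tile m z `<=` W'.
Proof.
move=> m0 hW Wz v hv; have m20 : 0 < 2 * m by lra.
have := hW _ _ Wz (_ : `|v - (2 * m) *: latpt R z| <= _).
by rewrite subrKC; apply; rewrite -hv vfloor_scale_norm.
Qed.

Lemma cnt_le_vol m W W' : 0 < m -> bdd W -> bdd W' -> thick m W W' ->
  m ^+ n * (cnt m W)%:R <= vol W'.
Proof.
by move=> m0 bW bW' hW; rewrite -lee_fin -volE//; exact: cnt_le_volume.
Qed.

Lemma vol_le_cnt m W W' : 0 < m -> bdd W' -> thick m W W' -> bdd W ->
  vol W <= m ^+ n * (cnt m W')%:R.
Proof.
by move=> m0 bW hW bW'; rewrite -lee_fin -volE//; exact: volume_le_cnt.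
Qed.

(** The points of [r S] are grouped by tiles: [tile_count] bounds each group, and the volume bounds
    the number of tiles. Two displacements by the side [2 * m] produce the constant [4 * c]: one
    between a point and the corner of its tile, one between the corners and the volume. *)
Lemma count_bounds X : periodic_set X -> exists2 C, 0 < C & forall S, star S ->
  exists2 c, 0 < c & forall r m, 0 < m -> c * m < r ->
    (ncard (X `&` dilate r S))%:R * (2 * m) ^+ n <=
      (r + c * m) ^+ n * vol S * (cube_count X (m + C))%:R /\
    (r - c * m) ^+ n * vol S * (cube_count X (m - C))%:R <=
      (ncard (X `&` dilate r S))%:R * (2 * m) ^+ n.
Proof.
move=> pX; have [C C0 hC] := tile_count pX; have [fX _] := pX.
exists C => // S sS; have [c c0 hS] := star_fat sS; have [bS _ _] := sS.
exists (4 * c) => [|r m m0 mr]; first lra.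
have cm0 : 0 < c * m by rewrite mulr_gt0.
have r0 : 0 < r by lra.
have m20 : 0 < 2 * m by lra.
have bD x : bdd (dilate x S) by exact: bdd_dilate.
have mn0 : 0 <= (2 * m) ^+ n by rewrite exprn_ge0 ?ltW.
split.
  have h1 : thick (2 * m) (dilate r S) (dilate (r + 2 * (c * m)) S).
    by have [] := hS (2 * m) r; rewrite 1?mulrCA ?mulr_ge0//; lra.
  have h2 : thick (2 * m) (dilate (r + 2 * (c * m)) S) (dilate (r + 4 * c * m) S).
    have [||+ _] := hS (2 * m) (r + 2 * (c * m)); [lra|lra|].
    by congr (thick _ _ (dilate _ _)); lra.
  rewrite -(vol_dilate sS); last by lra.
  have := cnt_le_vol m20 (bD _) (bD _) h2.
  move=> /(ler_wpM2r (ler0n R (cube_count X (m + C)))); apply: le_trans.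
  rewrite mulrC -mulrA ler_wpM2l// -natrM ler_nat.
  apply: (@ncard_fiber_le _ _ (fun v => vfloor ((2 * m)^-1 *: v))).
  - exact: locfin_bdd.
  - exact: finite_cnt.
  - by move=> x [_ Sx]; exact: thick_tile h1 Sx.
  move=> z _; rewrite (leq_trans _ (hC m z m0).2)//; apply: ncard_sub.
    apply: locfin_bdd => //; exists (m + `|tile_center m z|) => v /(tile_norm m0) hv.
    by rewrite -[v](subrK (tile_center m z)) (le_trans (ler_normD _ _))// lerD2r.
  by move=> x [[Xx _] hx].
have h1 : thick (2 * m) (dilate (r - 2 * (c * m)) S) (dilate r S).
  by have [] := hS (2 * m) r; rewrite 1?mulrCA ?mulr_ge0//; lra.
have h2 : thick (2 * m) (dilate (r - 4 * c * m) S) (dilate (r - 2 * (c * m)) S).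
  have [||_ +] := hS (2 * m) (r - 2 * (c * m)); [lra|lra|].
  by congr (thick _ (dilate _ _) _); lra.
rewrite -(vol_dilate sS); last by lra.
have := vol_le_cnt m20 (bD _) h2 (bD _).
move=> /(ler_wpM2r (ler0n R (cube_count X (m - C)))) /le_trans; apply.
rewrite mulrC [leRHS]mulrC mulrCA ler_wpM2l// mulrC -natrM ler_nat.
apply: (@ncard_fiber_ge _ _ (fun v => vfloor ((2 * m)^-1 *: v))).
- exact: locfin_bdd.
- exact: finite_cnt.
move=> z /= hz; rewrite (leq_trans (hC m z m0).1)//; apply: ncard_sub.
  by apply: finite_setIl; exact: locfin_bdd.
by move=> x [Xx hx]; do 2 split => //; exact: thick_tile_sub h1 hz _ hx.
Qed.

(** A single [nu] serves all windows [S]; this lets the window be transported by a linear map in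
    [has_density_lin_le]. *)
Definition has_density X (nu : R) := forall S, star S -> forall e, 0 < e ->
  exists R0, forall r, R0 <= r ->
    (nu - e) * vol S * r ^+ n <= (ncard (X `&` dilate r S))%:R /\
    (ncard (X `&` dilate r S))%:R <= (nu + e) * vol S * r ^+ n.

(* [nu] is the infimum over [m] of the number of points in a cube of side
   [2 * (m + C)], divided by the volume of a cube of side [2 * m]. *)
Lemma periodic_density X : periodic_set X -> exists2 nu, 0 <= nu & has_density X nu.
Proof.
move=> pX; have [C C0 hC] := count_bounds pX.
pose b m : R := (cube_count X (m + C))%:R / (2 * m) ^+ n.
pose D := [set b m | m in [set m : R | 0 < m]].
have b0 m : 0 < m -> 0 <= b m.
  by move=> m0; rewrite divr_ge0// exprn_ge0// mulr_ge0// ltW.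
have D0 : D !=set0 by exists (b 1), 1 => /=; rewrite ?ltr01.
have lD : lbound D 0 by move=> _ [m m0 <-]; exact: b0.
have hD : has_inf D by split => //; exists 0.
pose nu := inf D.
have nu0 : 0 <= nu by exact: lb_le_inf.
have nub m : 0 < m -> nu <= b m by move=> m0; apply: ge_inf; [exists 0|exists m].
exists nu => // S sS e e0; have [c c0 hS] := hC _ sS.
have V0 := star_vol_gt0 sS.
have [_ [m m0 <-] hm] := @inf_adherent _ D (e / 2) (divr_gt0 e0 (ltr0Sn R 1)) hD.
(* Chosen so that (1 + e1)(nu + e/2) <= nu + e and nu - e <= nu (1 - e1)^2. *)
pose e1 := e / (2 * nu + 2 + e).
have q0 : 0 < 2 * nu + 2 + e by lra.
have e10 : 0 < e1 by rewrite divr_gt0.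
have e1E : e1 * (2 * nu + 2 + e) = e by rewrite /e1 mulfVK ?gt_eqF.
have e11 : 0 <= 1 - e1 by rewrite subr_ge0 ltW// /e1 ltr_pdivrMr// mul1r; lra.
have C40 : 0 <= 4 * C by rewrite mulr_ge0// ltW.
have [M [M0 M1 hM]] := expr_shift n C40 e10.
(* The near-optimal [m] serves the upper bound. For the lower one any large [m'] will do: [nu] is at
   most [b (m' - 2 * C)], which bounds [cube_count X (m' - C)] from below. *)
pose m' := M + C; have m'0 : 0 < m' by rewrite addr_gt0.
have m2C : 0 < m' - 2 * C by rewrite /m'; lra.
have lowb : nu * (1 - e1) * (2 * m') ^+ n <= (cube_count X (m' - C))%:R.
  have := nub _ m2C; rewrite /b ler_pdivlMr; last by rewrite exprn_gt0// mulr_gt0.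
  rewrite (_ : m' - 2 * C + C = m' - C); last by lra.
  apply: le_trans; rewrite -mulrA ler_wpM2l//.
  have M2 : M <= 2 * m' by rewrite /m'; lra.
  have [_] := hM _ M2.
  by rewrite (_ : 2 * m' - 4 * C = 2 * (m' - 2 * C)); last by lra.
have [R1 [R10 R11 hR1]] := expr_shift n (ltW (mulr_gt0 c0 m0)) e10.
have [R2 [R20 R21 hR2]] := expr_shift n (ltW (mulr_gt0 c0 m'0)) e10.
exists (R1 + R2) => r hr.
have r0 : 0 < r by lra.
have rn0 : 0 < r ^+ n by rewrite exprn_gt0.
have VR : 0 < vol S * r ^+ n by rewrite mulr_gt0.
split.
  have rm' : c * m' < r by lra.
  have [_] := hS r m' m'0 rm'.
  have [|_ hp] := hR2 r; first lra.
  have mn0 : 0 < (2 * m') ^+ n by rewrite exprn_gt0// mulr_gt0.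
  move=> h; rewrite -(ler_pM2r mn0) (le_trans _ h)//.
  apply: (@le_trans _ _ ((1 - e1) * r ^+ n * vol S * (nu * (1 - e1) * (2 * m') ^+ n))).
    rewrite (_ : _ * (2 * m') ^+ n = (nu - e) * ((vol S * r ^+ n) * (2 * m') ^+ n)); last by ring.
    rewrite [leRHS](_ : _ = (nu * (1 - e1) ^+ 2) * ((vol S * r ^+ n) * (2 * m') ^+ n)); last by ring.
    rewrite ler_wpM2r//; first exact: ltW (mulr_gt0 VR mn0).
    have := mulr_ge0 nu0 (sqr_ge0 e1).
    by nra.
  apply: ler_pM => //.
  - by rewrite !mulr_ge0 ?(ltW rn0) ?(ltW V0).
  - by rewrite !mulr_ge0 ?(ltW mn0).
  - by rewrite ler_wpM2r// ltW.
have rm : c * m < r by lra.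
have [+ _] := hS r m m0 rm.
have [|hp _] := hR1 r; first lra.
have mn0 : 0 < (2 * m) ^+ n by rewrite exprn_gt0// mulr_gt0.
move=> h; rewrite -(ler_pM2r mn0) (le_trans h)//.
have hm' : (cube_count X (m + C))%:R <= (nu + e / 2) * (2 * m) ^+ n.
  by rewrite -ler_pdivrMr// ltW.
apply: (@le_trans _ _ ((1 + e1) * r ^+ n * vol S * ((nu + e / 2) * (2 * m) ^+ n))).
  apply: ler_pM => //.
  - by rewrite mulr_ge0 ?vol_ge0// exprn_ge0// addr_ge0 ?(ltW r0)// mulr_ge0 ?(ltW c0) ?(ltW m0).
  - by rewrite ler_wpM2r// ltW.
rewrite [leRHS](_ : _ = (nu + e) * ((vol S * r ^+ n) * (2 * m) ^+ n)); last by ring.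
rewrite [leLHS](_ : _ = ((1 + e1) * (nu + e / 2)) * ((vol S * r ^+ n) * (2 * m) ^+ n)); last by ring.
rewrite ler_wpM2r//; first exact: ltW (mulr_gt0 VR mn0).
by nra.
Qed.

Lemma mulmx_inj A : A \in unitmx -> injective (fun v => v *m A).
Proof.
by move=> uA v w /(congr1 (mulmx^~ (invmx A))) /=; rewrite !mulmxK.
Qed.

(** The map [x |-> x *m A] is a bijection from the points of [X] in [r S] onto those of the image in
    [r (S A)], so one count has two asymptotic expressions and no determinant is involved. The
    converse inequality is this one for [invmx A]. *)
Lemma has_density_lin_le X A nu nu' S : locfin X -> has_density X nu -> has_density (lin A X) nu' ->
  A \in unitmx -> star S -> nu' * vol (lin A S) <= nu * vol S.
Proof.
move=> fX hX hY uA sS; have sAS := star_lin uA sS.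
have V0 := star_vol_gt0 sS; have V'0 := star_vol_gt0 sAS.
apply/ler_addgt0Pr => e e0.
pose d := e / (vol S + vol (lin A S)).
have d0 : 0 < d by rewrite divr_gt0// addr_gt0.
have dE : d * (vol S + vol (lin A S)) = e by rewrite /d mulfVK// gt_eqF// addr_gt0.
have [R1 h1] := hX _ sS _ d0; have [R2 h2] := hY _ sAS _ d0.
pose r := `|R1| + `|R2| + 1.
have r0 : 0 < r by have := normr_ge0 R1; have := normr_ge0 R2; rewrite /r; lra.
have rR1 : R1 <= r by have := ler_norm R1; have := normr_ge0 R2; rewrite /r; lra.
have rR2 : R2 <= r by have := ler_norm R2; have := normr_ge0 R1; rewrite /r; lra.
have [_ u1] := h1 _ rR1; have [u2 _] := h2 _ rR2.
have E : ncard (lin A X `&` dilate r (lin A S)) = ncard (X `&` dilate r S).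
  rewrite -lin_dilate -(@ncard_image _ _ (mulmx^~ A) (X `&` dilate r S)).
  - congr ncard; apply/seteqP; split => [_ [[x Xx <-] [y Sy /(mulmx_inj uA) yx]]|].
      by exists x => //; split => //; rewrite -yx.
    by move=> _ [x [Xx Sx] <-]; split; exists x.
  - by apply: locfin_bdd => //; apply: bdd_dilate; case: sS.
  - by move=> x y _ _ h; exact: (mulmx_inj uA h).
move: u2; rewrite E => /le_trans/(_ u1).
rewrite ler_pM2r ?exprn_gt0// -dE => h; lra.
Qed.

Lemma periodic_lin X A : A \in unitmx -> periodic_set X -> periodic_set (lin A X).
Proof.
move=> uA [fX [B uB iX]]; split.
  move=> C; have [C' C'0 hC'] := mulmx_bound (invmx A).
  apply: (@sub_finite_set _ _ (mulmx^~ A @` (X `&` [set x | `|x| <= C' * C]))).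
    move=> _ [[x Xx <-] /= hx]; exists x => //; split => //=.
    by rewrite -[x](mulmxK uA) (le_trans (hC' _))// ler_wpM2l// ltW.
  exact: finite_image.
exists (B *m A); first by rewrite unitmx_mul uB.
move=> _ z [x Xx <-]; exists (x + latpt R z *m B); first exact: iX.
by rewrite mulmxDl mulmxA.
Qed.

Lemma linK A X : A \in unitmx -> lin (invmx A) (lin A X) = X.
Proof.
move=> uA; apply/seteqP; split => [_ [_ [x Tx <-] <-]|x Tx]; first by rewrite mulmxK.
by exists (x *m A); [exists x|rewrite mulmxK].
Qed.

Lemma periodic_density_lin X A nu S : periodic_set X -> has_density X nu ->
  A \in unitmx -> star S ->
  exists nu', [/\ 0 <= nu', has_density (lin A X) nu' & nu' * vol (lin A S) = nu * vol S].
Proof.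
move=> pX hX uA sS; have pAX := periodic_lin uA pX.
have [nu' nu'0 hAX] := periodic_density pAX.
exists nu'; split => //; apply/le_anti/andP; split.
  exact: has_density_lin_le (proj1 pX) hX hAX uA sS.
rewrite -[S in nu * vol S](linK _ uA); apply: (@has_density_lin_le (lin A X)).
- by case: pAX.
- exact: hAX.
- by rewrite (linK _ uA).
- by rewrite unitmx_inv.
- exact: star_lin.
Qed.

End lattice_point_counting.

(** * Density of a family of translates *)

Section limits_at_infinity.
Variable R : realType.
Implicit Types (f : R -> \bar R) (a : \bar R).
Local Open Scope ereal_scope.

Lemma limf_esup_le f a (R0 : R) : (forall r, (R0 < r)%R -> f r <= a) ->
  limf_esup f (pinfty_nbhs R) <= a.
Proof.
move=> h; apply: ge_ereal_inf; exists (ereal_sup (f @` [set r | (R0 < r)%R])).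
  by exists [set r | (R0 < r)%R] => //; exists R0; split => //; exact: num_real.
by apply: ge_ereal_sup => _ [r hr <-]; exact: h.
Qed.

Lemma limf_esup_ge f a (R0 : R) : (forall r, (R0 < r)%R -> a <= f r) ->
  a <= limf_esup f (pinfty_nbhs R).
Proof.
move=> h; apply: le_ereal_inf_tmp => _ [V [M [_ hM]] <-].
apply: le_ereal_sup_tmp; exists (f (Num.max M R0 + 1)%R).
  exists (Num.max M R0 + 1)%R => //; apply: hM.
  by rewrite ltr_pwDr// le_max lexx.
by apply: h; rewrite ltr_pwDr// le_max lexx orbT.
Qed.

Lemma limf_esup_gt f a (R0 : R) : a < limf_esup f (pinfty_nbhs R) ->
  exists2 r, (R0 < r)%R & a < f r.
Proof.
move=> h; apply: contrapT => hN; move: h; apply/negP; rewrite -leNgt.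
apply: (@limf_esup_le _ _ R0) => r Rr; rewrite leNgt; apply/negP => ar.
by apply: hN; exists r.
Qed.

Lemma limf_einf_le f a (R0 : R) : (forall r, (R0 < r)%R -> f r <= a) ->
  limf_einf f (pinfty_nbhs R) <= a.
Proof.
move=> h; rewrite /limf_einf leeNl; apply: (@limf_esup_ge _ _ R0) => r /h.
by rewrite leeN2.
Qed.

Lemma limf_einf_ge f a (R0 : R) : (forall r, (R0 < r)%R -> a <= f r) ->
  a <= limf_einf f (pinfty_nbhs R).
Proof.
move=> h; rewrite /limf_einf leeNr; apply: (@limf_esup_le _ _ R0) => r /h.
by rewrite leeN2.
Qed.

Lemma limf_einf_lt f a (R0 : R) : limf_einf f (pinfty_nbhs R) < a ->
  exists2 r, (R0 < r)%R & f r < a.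
Proof.
rewrite /limf_einf lteNl => /(@limf_esup_gt _ _ R0) [r Rr].
by rewrite lteN2; exists r.
Qed.

End limits_at_infinity.

Section translates_of_a_body.
Variables (R : realType) (n : nat).
Implicit Types (x y v w t u : 'rV[R]_n) (m r e : R) (S W X K : set 'rV[R]_n).

(** If [d = x - y] were nonzero, a point of the bounded set [K] could be moved inside [K] by every
    natural multiple of [d]. This lets densities, defined by sums over sets, be computed by counting
    translation vectors. *)
Lemma translate_inj K x y : bdd K -> K !=set0 -> translate x K = translate y K -> x = y.
Proof.
move=> [C hC] [k0 Kk0] E; apply/eqP; rewrite -subr_eq0; set d := x - y.
have Kd k : K k -> K (k + d).
  move=> Kk; have : translate x K (k + x) by exists k.
  by rewrite E => -[k' Kk' kk]; rewrite /d addrA -kk addrK.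
have Kj j : K (k0 + j%:R *: d).
  elim: j => [|j IH]; first by rewrite scale0r addr0.
  by rewrite -natr1 scalerDl scale1r addrA; exact: Kd.
have C0 : 0 <= C by exact: le_trans (hC _ Kk0).
apply/negPn/negP => d0; have nd0 : 0 < `|d| by rewrite normr_gt0.
pose j := Num.bound ((C + C) / `|d|).
have hj : (C + C) / `|d| < j%:R by apply: archi_boundP; rewrite divr_ge0 ?addr_ge0.
move: hj; rewrite ltr_pdivrMr// ltNge => /negP; apply.
rewrite -[X in X * _](ger0_norm (ler0n R j)) -normrZ -[_ *: d](addKr k0).
by rewrite (le_trans (ler_normD _ _))// normrN lerD// hC.
Qed.

Lemma interior_subP K v : interior K v <-> exists2 e, 0 < e & forall u, `|u| < e -> K (v + u).
Proof.
rewrite /interior -nbhs_ballE; split.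
  move=> [e /= e0 he]; exists e => // u hu; apply: he.
  by rewrite -ball_normE /ball_/= opprD addrA subrr add0r normrN.
move=> [e e0 he]; exists e => // w; rewrite -ball_normE /ball_/= distrC => hw.
by rewrite -(subrK v w) addrC; exact: he.
Qed.

Lemma interior_translate K x : interior (translate x K) = translate x (interior K).
Proof.
apply/seteqP; split => [v /interior_subP[e e0 he]|_ [v /interior_subP[e e0 he] <-]].
  exists (v - x); last by rewrite subrK.
  apply/interior_subP; exists e => // u /he [k Kk kE].
  by rewrite addrAC -kE addrK.
by apply/interior_subP; exists e => // u /he Ku; exists (v + u) => //; rewrite addrAC.
Qed.

(* Since translation is injective on bodies, this is the disjointness part of
   [packing (translates K X)]. *)
Definition packs K X := forall x y u v, X x -> X y -> interior K u -> interior K v ->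
  u + x = v + y -> x = y.

Lemma packing_packs K X : bdd K -> K !=set0 -> packing (translates K X) -> packs K X.
Proof.
move=> bK K0 [_ tF] x y u v Xx Xy Ku Kv E; apply: (translate_inj bK K0).
apply: tF; [by exists x|by exists y|].
exists (u + x); rewrite !interior_translate; split; first by exists u.
by rewrite E; exists v.
Qed.

Lemma packs_packing K X : countable X -> packs K X -> packing (translates K X).
Proof.
move=> cX pX; split; first exact: card_le_trans (card_image_le _ _) cX.
move=> _ _ [x Xx <-] [y Xy <-] [w []]; rewrite !interior_translate.
move=> [u Ku uw] [v Kv vw]; congr translate; apply: (pX x y u v) => //.
by rewrite uw vw.
Qed.

Definition covers K X := forall v, exists2 x, X x & K (v - x).

Lemma covering_covers K X : covering (translates K X) -> covers K X.
Proof.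
move=> [_ E] v; have : (\bigcup_(A in translates K X) A) v by rewrite E.
by move=> [_ [x Xx <-] [k Kk <-]]; exists x => //; rewrite addrK.
Qed.

Lemma covers_covering K X : countable X -> covers K X -> covering (translates K X).
Proof.
move=> cX pX; split; first exact: card_le_trans (card_image_le _ _) cX.
apply/seteqP; split => // v _; have [x Xx Kx] := pX v.
by exists (translate x K); [exists x|exists (v - x) => //; rewrite subrK].
Qed.

Lemma locfin_countable X : locfin X -> countable X.
Proof.
move=> fX; rewrite (_ : X = \bigcup_(k in [set: nat]) (X `&` [set v | `|v| <= k%:R])).
  apply: bigcup_countable => // k _; exact: finite_set_countable.
apply/seteqP; split => [x Xx|x [k _ []//]].
exists (Num.bound `|x|) => //; split => //=; exact/ltW/archi_boundP.
Qed.

Definition hits K X r := [set x | X x /\ translate x K `&` dilate r (@unit_ball R n) !=set0].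

Local Notation ballvol r := (r ^+ n * vol (@unit_ball R n)).

Lemma ballvol_gt0 r : 0 < r -> 0 < ballvol r.
Proof. by move=> r0; rewrite mulr_gt0 ?exprn_gt0// star_vol_gt0//; exact: star_unit_ball. Qed.

Lemma density_in_ballE S t X r : star S -> 0 < r ->
  density_in_ball (translates (translate t S) X) r =
  (((ballvol r)^-1)%:E * \esum_(x in hits (translate t S) X r) (vol S)%:E)%E.
Proof.
move=> sS r0; set K := translate t S.
have [bS S0 _] := sS; have bK : bdd K by rewrite /K -(dilate1 S); exact: bdd_affine.
have K0 : K !=set0 by case: S0 => s Ss; exists (s + t); exists s.
rewrite /density_in_ball -/(vol _) vol_dilate//; last exact: star_unit_ball.
congr (_ * _)%E.
rewrite (_ : [set A | _] = (fun x => translate x K) @` hits K X r); last first.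
  apply/seteqP; split => [_ [[x Xx <-] h]|_ [x [Xx h] <-]]; first by exists x.
  by split => //; exists x.
rewrite esum_image; last by move=> x y _ _; exact: (translate_inj bK K0).
apply: eq_esum => x _; rewrite translateD volE ?vol_translate//.
by rewrite -(dilate1 S); exact: bdd_affine.
Qed.

Lemma fsum_cst (T : choiceType) (P : set T) (a : R) : finite_set P ->
  (\sum_(x \in P) a%:E = ((ncard P)%:R * a)%:E)%E.
Proof.
move=> fP; rewrite fsbig_finite//= sumEFin; congr EFin.
by rewrite big_const_seq count_predT iter_addr_0 mulr_natl.
Qed.

(** Here [X] may fail to be locally finite, so the sum is approached through finite sets of vectors,
    of which it is the supremum. *)
Lemma density_in_ball_ge S t X r (P : set 'rV[R]_n) : star S -> 0 < r -> finite_set P ->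
  P `<=` hits (translate t S) X r ->
  (((ncard P)%:R * vol S / ballvol r)%:E <=
    density_in_ball (translates (translate t S) X) r)%E.
Proof.
move=> sS r0 fP PK; rewrite density_in_ballE// mulrC EFinM.
rewrite lee_wpmul2l//; first by rewrite lee_fin invr_ge0 ltW// ballvol_gt0.
by apply: esum_ge; exists P => //; rewrite fsum_cst.
Qed.

Lemma density_in_ball_le S t X r (d : \bar R) : star S -> 0 < r ->
  (forall P, finite_set P -> P `<=` hits (translate t S) X r ->
    (((ncard P)%:R * vol S / ballvol r)%:E <= d)%E) ->
  (density_in_ball (translates (translate t S) X) r <= d)%E.
Proof.
move=> sS r0 h; rewrite density_in_ballE// lee_pdivrMl ?ballvol_gt0//.
apply: ge_ereal_sup => _ [P [fP PK] <-]; rewrite fsum_cst//.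
have := h P fP PK; rewrite mulrC EFinM lee_pdivrMl ?ballvol_gt0//.
Qed.

Lemma density_in_ball_gt S t X r (d : R) : star S -> 0 < r ->
  (d%:E < density_in_ball (translates (translate t S) X) r)%E ->
  exists P, [/\ finite_set P, P `<=` hits (translate t S) X r &
    d < (ncard P)%:R * vol S / ballvol r].
Proof.
move=> sS r0 h; apply: contrapT => hP.
move: h; apply/negP; rewrite -leNgt; apply: density_in_ball_le => // P fP PK.
by rewrite lee_fin leNgt; apply/negP => dP; apply: hP; exists P.
Qed.

(** A translation vector and a point of its translate differ by at most [D], so counting translates
    that meet a ball amounts to counting vectors in balls of nearly the same radius. *)
Lemma hits_sandwich S t : star S -> exists2 C, 0 < C & forall X r, C < r ->
  hits (translate t S) X r `<=` X `&` dilate (r + C) (@unit_ball R n) /\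
  X `&` dilate (r - C) (@unit_ball R n) `<=` hits (translate t S) X r.
Proof.
move=> [bS [s Ss] _]; have [D hD] := bdd_affine 1 t bS; rewrite dilate1 in hD.
have [c c0 hc] := star_fat ((@star_unit_ball R n)).
have D0 : 0 <= D by apply: le_trans (hD (s + t) _) => //; exists s.
have cD : 0 <= c * D by rewrite mulr_ge0// ltW.
exists (c * D + 1) => [|X r hr]; first lra.
have rD : c * D < r by lra.
have [h1 h2] := hc D r D0 rD; split => x [Xx].
  move=> [_ [[k Kk <-] kB]]; split => //.
  have : dilate (r + c * D) (@unit_ball R n) x.
    by rewrite -[x](addKr k) [- k + _]addrC; apply: h1; rewrite ?normrN//; exact: hD.
  by apply: star_dilate_sub; [exact: star_unit_ball|lra|lra].
move=> xB; split => //; exists (s + t + x); split; first by exists (s + t) => //; exists s.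
rewrite [s + t + x]addrC; apply: h2; last by apply: hD; exists s.
by move: xB; apply: star_dilate_sub; [exact: star_unit_ball|lra|lra].
Qed.

Lemma finite_hits S t X r : star S -> locfin X -> finite_set (hits (translate t S) X r).
Proof.
move=> sS fX; have [C C0 hC] := hits_sandwich t sS.
have [bB _ _] := (@star_unit_ball R n); have [bS _ _] := sS.
have [D1 h1] := bdd_affine 1 t bS; have [D2 h2] := bdd_dilate r bB.
rewrite dilate1 in h1.
apply: (sub_finite_set _ (fX (D1 + D2))) => x [Xx [_ [[k /h1 hk <-] /h2 hx]]]; split => //=.
by rewrite -[x](addKr k) (le_trans (ler_normD _ _))// normrN lerD.
Qed.

Lemma has_density_hits S t X nu : star S -> locfin X -> 0 <= nu -> has_density X nu ->
  forall e, 0 < e -> exists R0, forall r, R0 < r ->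
   (((nu - e) * vol S)%:E <= density_in_ball (translates (translate t S) X) r <=
    ((nu + e) * vol S)%:E)%E.
Proof.
move=> sS fX nu0 hX e e0.
have [C C0 hC] := hits_sandwich t sS.
have sB := (@star_unit_ball R n); have V0 := star_vol_gt0 sB; have VS := star_vol_gt0 sS.
have e20 : 0 < e / 2 by rewrite divr_gt0.
have [R1 h1] := hX _ sB _ e20.
pose e1 := e / (2 * nu + 2 + e).
have q0 : 0 < 2 * nu + 2 + e by lra.
have e10 : 0 < e1 by rewrite divr_gt0.
have e1E : e1 * (2 * nu + 2 + e) = e by rewrite /e1 mulfVK ?gt_eqF.
have [R2 [R20 R21 h2]] := expr_shift n (ltW C0) e10.
exists (`|R1| + C + R2) => r hr.
have R1r : R1 <= r - C by have := ler_norm R1; lra.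
have R1r' : R1 <= r + C by have := ler_norm R1; lra.
have Cr : C < r by have := normr_ge0 R1; lra.
have r0 : 0 < r by lra.
have rn0 : 0 < r ^+ n by rewrite exprn_gt0.
have [|s1 s2] := h2 r; first by have := normr_ge0 R1; lra.
have [k1 k2] := hC X r Cr.
have bB (q : R) : bdd (dilate q (@unit_ball R n)) by apply: bdd_dilate; case: sB.
have N0 : (0 : R) <= (ncard (hits (translate t S) X r))%:R by [].
apply/andP; split.
  apply: le_trans (density_in_ball_ge sS r0 (finite_hits _ _ sS fX) (fun x h => h)).
  rewrite lee_fin ler_pdivlMr ?ballvol_gt0// [leLHS]mulrAC ler_wpM2r ?(ltW VS)//.
  (* If [nu - e / 2] is not positive the bound is trivial; otherwise it may multiply [s2]. *)
  have [ne|en] := leP (nu - e / 2) 0.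
    apply: le_trans N0; rewrite mulr_le0_ge0 ?(ltW (ballvol_gt0 r0))//; lra.
  have := ncard_sub (finite_hits t r sS fX) k2; rewrite -(ler_nat R); apply: le_trans.
  apply: le_trans (h1 _ R1r).1.
  rewrite [leLHS](_ : _ = vol (@unit_ball R n) * ((nu - e) * r ^+ n)); last by ring.
  rewrite [leRHS](_ : _ = vol (@unit_ball R n) * ((nu - e / 2) * (r - C) ^+ n)); last by ring.
  rewrite ler_wpM2l ?(ltW V0)//.
  apply: le_trans (ler_wpM2l (ltW en) s2).
  by rewrite mulrA ler_wpM2r ?(ltW rn0)//; nra.
apply: density_in_ball_le => // P fP hP.
rewrite lee_fin ler_pdivrMr ?ballvol_gt0// [leRHS]mulrAC ler_wpM2r ?(ltW VS)//.
have fXr : finite_set (X `&` dilate (r + C) (@unit_ball R n)) by exact: locfin_bdd.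
have := ncard_sub fXr (subset_trans hP k1); rewrite -(ler_nat R) => /le_trans; apply.
apply: le_trans (h1 _ R1r').2 _.
have en : 0 <= nu + e / 2 by lra.
apply: (@le_trans _ _ (vol (@unit_ball R n) * ((nu + e / 2) * ((1 + e1) * r ^+ n)))).
  rewrite [leLHS](_ : _ = vol (@unit_ball R n) * ((nu + e / 2) * (r + C) ^+ n)); last by ring.
  by rewrite ler_wpM2l ?(ltW V0)// ler_wpM2l.
rewrite [leLHS](_ : _ = ((nu + e / 2) * (1 + e1)) * vol (@unit_ball R n) * r ^+ n); last by ring.
rewrite [leRHS](_ : _ = (nu + e) * vol (@unit_ball R n) * r ^+ n); last by ring.
by rewrite ler_wpM2r ?(ltW rn0)// ler_wpM2r ?(ltW V0)//; nra.
Qed.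

Lemma le_of_near (a b : R) (x : \bar R) : 0 < b ->
  (forall e, 0 < e -> (((a - e) * b)%:E <= x <= ((a + e) * b)%:E)%E) ->
  x = (a * b)%:E.
Proof.
move=> b0 h; apply/le_anti/andP; split; apply/lee_addgt0Pr => e e0.
  have [_] := andP (h (e / b) (divr_gt0 e0 b0)); move=> /le_trans; apply.
  by rewrite -EFinD lee_fin mulrDl mulfVK ?gt_eqF.
have [+ _] := andP (h (e / b) (divr_gt0 e0 b0)); rewrite mulrBl mulfVK ?gt_eqF// EFinB.
by rewrite leeBlDr.
Qed.

Lemma packing_density_periodic S t X nu : star S -> locfin X -> 0 <= nu ->
  has_density X nu ->
  packing_density (translates (translate t S) X) = (nu * vol S)%:E.
Proof.
move=> sS fX nu0 hX; apply: le_of_near; first exact: star_vol_gt0.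
move=> e e0; have [R0 h] := has_density_hits t sS fX nu0 hX e0.
apply/andP; split.
  by apply: (@limf_esup_ge _ _ _ R0) => r /h /andP[].
by apply: (@limf_esup_le _ _ _ R0) => r /h /andP[].
Qed.

Lemma covering_density_periodic S t X nu : star S -> locfin X -> 0 <= nu ->
  has_density X nu ->
  covering_density (translates (translate t S) X) = (nu * vol S)%:E.
Proof.
move=> sS fX nu0 hX; apply: le_of_near; first exact: star_vol_gt0.
move=> e e0; have [R0 h] := has_density_hits t sS fX nu0 hX e0.
apply/andP; split.
  by apply: (@limf_einf_ge _ _ _ R0) => r /h /andP[].
by apply: (@limf_einf_le _ _ _ R0) => r /h /andP[].
Qed.

End translates_of_a_body.

(** * Periodic repetition of a finite set *)

Lemma ereal_lt_between (R : realType) (d : R) (x : \bar R) : (d%:E < x)%E ->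
  exists2 d', d < d' & (d'%:E < x)%E.
Proof.
case: x => [x| |//]; last by exists (d + 1); rewrite ?ltry// ltrDl.
by rewrite lte_fin => dx; exists ((d + x) / 2); rewrite ?lte_fin ?midf_lt.
Qed.

Lemma ereal_gt_between (R : realType) (d : R) (x : \bar R) : (x < d%:E)%E ->
  exists2 d', d' < d & (x < d'%:E)%E.
Proof.
case: x => [x|//|]; last by exists (d - 1); rewrite ?ltNyr// ltrBlDr ltrDl.
by rewrite lte_fin => dx; exists ((x + d) / 2); rewrite ?lte_fin ?midf_lt.
Qed.

(** One factor [1 + e] pays for the padding or overlap of the period cell, the other for the
    boundary layer of the ball. The choice of [e] rests on (1 + e)^2 <= 1 + 3 e for 0 <= e <= 1. *)
Lemma sqr_slack (R : realFieldType) (a b : R) : 0 < a -> a < b ->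
  exists2 e, 0 < e & a * (1 + e) * (1 + e) <= b.
Proof.
move=> a0 ab; pose e := (b - a) / (3 * a + (b - a)).
have q0 : 0 < 3 * a + (b - a) by lra.
have ba : 0 < b - a by rewrite subr_gt0.
have e0 : 0 < e by rewrite divr_gt0.
have e1 : e <= 1 by rewrite /e ler_pdivrMr// mul1r; lra.
have eE : e * (3 * a + (b - a)) = b - a by rewrite /e mulfVK// gt_eqF.
exists e => //.
have e1' : 0 <= 1 - e by rewrite subr_ge0.
have h1 : 0 <= a * e * (1 - e) := mulr_ge0 (ltW (mulr_gt0 a0 e0)) e1'.
have h2 : 0 <= e * (b - a) := ltW (mulr_gt0 e0 ba).
by nra.
Qed.

Section periodization.
Variables (R : realType) (n : nat).
Implicit Types (v w t u p : 'rV[R]_n) (m r e : R) (S W X K P : set 'rV[R]_n).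
Local Notation ball1 := (@unit_ball R n).
Local Notation star_ball := (@star_unit_ball R n).

Definition perio m P := [set x | exists z, P (x - m *: latpt R z)].

Lemma finite_bdd P : finite_set P -> bdd P.
Proof.
move=> fP; exists (\sum_(p <- fset_set P) `|p|) => w Pw.
rewrite (big_fsetD1 w)/= ?in_fset_set ?inE// lerDl.
by rewrite sumr_ge0.
Qed.

Lemma perio_periodic m P : 0 < m -> finite_set P -> periodic_set (perio m P).
Proof.
move=> m0 fP; split.
  move=> C; have [D hD] := finite_bdd fP.
  have fZ := finite_latpt n ((C + D) / m).
  pose g (pz : 'rV[R]_n * 'rV[int]_n) := pz.1 + m *: latpt R pz.2.
  have := finite_image g (finite_setX fP fZ); apply: sub_finite_set.
  move=> x [[z Pz] /= xC]; exists (x - m *: latpt R z, z); last by rewrite /g/= subrK.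
  split => //=; rewrite ler_pdivlMr// mulrC -[X in X * _](gtr0_norm m0) -normrZ.
  rewrite (_ : _ *: _ = x - (x - m *: latpt R z)); last by rewrite opprB addrC subrK.
  by rewrite (le_trans (ler_normB _ _))// lerD// hD.
exists (m%:M); first by rewrite unitmxE det_scalar unitfE expf_neq0// gt_eqF.
move=> x z [z' Pz]; exists (z' + z).
by rewrite mul_mx_scalar latptD scalerDr opprD addrACA subrr addr0.
Qed.

Lemma cnt_ball m : 0 < m -> exists2 c, 0 < c & forall r, c < r ->
  (r - c) ^+ n * vol ball1 <= m ^+ n * (cnt m (dilate r ball1))%:R /\
  m ^+ n * (cnt m (dilate r ball1))%:R <= (r + c) ^+ n * vol ball1.
Proof.
move=> m0; have [c c0 hc] := star_fat star_ball.
have [bB _ _] := star_ball.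
have cm0 : 0 < c * m by rewrite mulr_gt0.
exists (c * m) => // r rc; have [h1 h2] := hc m r (ltW m0) rc.
rewrite -!(vol_dilate star_ball); [|lra|lra].
by split; [apply: vol_le_cnt|apply: cnt_le_vol] => //; exact: bdd_dilate.
Qed.

(** All of [P] lies in one cell of side [l <= m], so its translates by [m Z^n] are disjoint and each
    contributes [ncard P] points. The translates counted have their vector in the ball of radius
    [r - c2 * D], hence stay in the ball of radius [r]. *)
Lemma perio_density_ge m l P z0 nu : 0 < l -> l <= m -> finite_set P ->
  (forall p, P p -> vfloor (l^-1 *: p) = z0) -> has_density (perio m P) nu ->
  (ncard P)%:R <= nu * m ^+ n.
Proof.
move=> l0 lm fP hP hnu; have m0 : 0 < m by exact: lt_le_trans lm.
have V0 := star_vol_gt0 star_ball.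
have [fX _] := perio_periodic m0 fP; have [bB _ _] := star_ball.
have [D0 hD0] := finite_bdd fP; pose D := `|D0|.
have hD p : P p -> `|p| <= D by move=> /hD0 h; exact: le_trans (ler_norm _).
have [c1 c10 h1] := cnt_ball m0; have [c2 c20 h2] := star_fat star_ball.
have mn0 : 0 < m ^+ n by rewrite exprn_gt0.
pose C := c2 * D + c1; have c2D : 0 <= c2 * D := mulr_ge0 (ltW c20) (normr_ge0 D0).
have C0 : 0 <= C by rewrite addr_ge0// ltW.
apply/ler_addgt0Pr => e e0.
pose N : R := (ncard P)%:R; have N0 : 0 <= N by [].
have q0 : 0 < N + m ^+ n by rewrite ltr_wpDl.
pose e1 := e / (N + m ^+ n); have e10 : 0 < e1 by rewrite divr_gt0.
have e1E : e1 * (N + m ^+ n) = e by rewrite /e1 mulfVK// gt_eqF.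
have [R1 hR1] := hnu _ star_ball _ e10.
have [R2 [R20 CR2 hR2]] := expr_shift n C0 e10.
pose r := `|R1| + R2; have r1 : R1 <= r by have := ler_norm R1; rewrite /r; lra.
have r2 : R2 <= r by have := normr_ge0 R1; rewrite /r; lra.
have r0 : 0 < r by lra.
have rn0 : 0 < r ^+ n by rewrite exprn_gt0.
have [_ u1] := hR1 r r1; have [_ u2] := hR2 r r2.
have rD : c2 * D < r by rewrite /C in CR2; lra.
have [_ th] := h2 D r (normr_ge0 _) rD.
have rc1 : c1 < r - c2 * D by rewrite /C in CR2; lra.
have [k1 _] := h1 _ rc1.
have bD : bdd (dilate (r - c2 * D) ball1) by exact: bdd_dilate.
have K : (cnt m (dilate (r - c2 * D) ball1) * ncard P <=
   ncard (perio m P `&` dilate r ball1))%N.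
  (* The origin is moved to the corner of the cell of [P], so that the period containing [p + m z]
     has index [z]. *)
  apply: (@ncard_fiber_ge _ _ (fun x => vfloor (m^-1 *: (x - l *: latpt R z0)))).
  - by apply: (locfin_bdd fX); exact: bdd_dilate.
  - exact: finite_cnt.
  move=> z hz; apply: (@ncard_inj _ _ (fun p => p + m *: latpt R z)).
  - by apply: finite_setIl; apply: (locfin_bdd fX); exact: bdd_dilate.
  - move=> p Pp; split; first split.
    + by exists z; rewrite /= addrK.
    + by rewrite addrC; exact: th hz (hD p Pp).
    rewrite /= (_ : m^-1 *: _ = latpt R z + m^-1 *: (p - l *: latpt R z0)); last first.
      by apply/rowP => i; rewrite !mxE; field; rewrite gt_eqF.
    rewrite vfloorD (_ : vfloor _ = 0) ?addr0//.
    apply/rowP => i; rewrite !mxE; apply/eqP; rewrite floor_eq.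
    have := hP p Pp => /rowP/(_ i); rewrite !mxE => E.
    have := floor_le (l^-1 * p ord0 i); have := floorD1_gt (l^-1 * p ord0 i).
    rewrite E ltr_pdivrMl// ler_pdivlMl// intrD => g1 g2.
    by rewrite ler_pdivlMl// ltr_pdivrMl// add0r mulr0 mulr1; apply/andP; split; lra.
  - by move=> x y _ _ /addIr.
have : (r - C) ^+ n * vol ball1 * N <= (nu + e1) * vol ball1 * r ^+ n * m ^+ n.
  apply: (@le_trans _ _ ((ncard (perio m P `&` dilate r ball1))%:R * m ^+ n)).
    rewrite (_ : r - C = r - c2 * D - c1); last by rewrite /C; lra.
    apply: (@le_trans _ _ (m ^+ n * (cnt m (dilate (r - c2 * D) ball1))%:R * N)).
      by rewrite ler_wpM2r.
    by rewrite -mulrA mulrC ler_wpM2r ?(ltW mn0)// /N -natrM ler_nat.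
  by rewrite ler_wpM2r ?(ltW mn0).
move=> H.
have : (1 - e1) * N * (r ^+ n * vol ball1) <= (nu + e1) * m ^+ n * (r ^+ n * vol ball1).
  apply: (@le_trans _ _ ((r - C) ^+ n * (vol ball1 * N))).
    rewrite [leLHS](_ : _ = (1 - e1) * r ^+ n * (vol ball1 * N)); last by ring.
    by rewrite ler_wpM2r// mulr_ge0// ltW.
  by move: H; congr (_ <= _); ring.
by rewrite ler_pM2r ?mulr_gt0//; nra.
Qed.

(** Copies of [P] may overlap here, which only lowers the count: each point is assigned to one of
    the copies containing it. *)
Lemma perio_density_le m P nu : 0 < m -> finite_set P -> has_density (perio m P) nu ->
  nu * m ^+ n <= (ncard P)%:R.
Proof.
move=> m0 fP hnu.
have V0 := star_vol_gt0 star_ball.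
have [fX _] := perio_periodic m0 fP; have [bB _ _] := star_ball.
have [D0 hD0] := finite_bdd fP; pose D := `|D0|.
have hD p : P p -> `|p| <= D by move=> /hD0 h; exact: le_trans (ler_norm _).
have [c1 c10 h1] := cnt_ball m0; have [c2 c20 h2] := star_fat star_ball.
have mn0 : 0 < m ^+ n by rewrite exprn_gt0.
pose C := c2 * D + c1; have c2D : 0 <= c2 * D := mulr_ge0 (ltW c20) (normr_ge0 D0).
have C0 : 0 <= C by rewrite addr_ge0// ltW.
apply/ler_addgt0Pr => e e0.
pose N : R := (ncard P)%:R; have N0 : 0 <= N by [].
have q0 : 0 < N + m ^+ n by rewrite ltr_wpDl.
pose e1 := e / (N + m ^+ n); have e10 : 0 < e1 by rewrite divr_gt0.
have e1E : e1 * (N + m ^+ n) = e by rewrite /e1 mulfVK// gt_eqF.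
have [R1 hR1] := hnu _ star_ball _ e10.
have [R2 [R20 CR2 hR2]] := expr_shift n C0 e10.
pose r := `|R1| + R2; have r1 : R1 <= r by have := ler_norm R1; rewrite /r; lra.
have r2 : R2 <= r by have := normr_ge0 R1; rewrite /r; lra.
have r0 : 0 < r by lra.
have rn0 : 0 < r ^+ n by rewrite exprn_gt0.
have [u1 _] := hR1 r r1; have [u2 _] := hR2 r r2.
have rD : c2 * D < r by rewrite /C in CR2; lra.
have [th _] := h2 D r (normr_ge0 _) rD.
have rc1 : c1 < r + c2 * D by rewrite /C in CR2; lra.
have [_ k1] := h1 _ rc1.
have /choice[f hf] : forall x, exists z, perio m P x -> P (x - m *: latpt R z).
  move=> x; have [[z hz]|h] := pselect (perio m P x); first by exists z.
  by exists 0.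
have K : (ncard (perio m P `&` dilate r ball1) <=
   cnt m (dilate (r + c2 * D) ball1) * ncard P)%N.
  apply: (@ncard_fiber_le _ _ f).
  - by apply: (locfin_bdd fX); exact: bdd_dilate.
  - exact: (finite_cnt m0 (bdd_dilate _ bB)).
  - move=> x [Xx Bx] /=.
    rewrite (_ : _ *: _ = x + - (x - m *: latpt R (f x))); last by rewrite opprB addrC subrK.
    by apply: th => //; rewrite normrN; exact/hD/hf.
  move=> z _; apply: (@ncard_inj _ _ (fun x => x - m *: latpt R z)) => //.
    by move=> x [[Xx _] /= <-]; exact: hf.
  by move=> x y _ _ /addIr.
have : (nu - e1) * vol ball1 * r ^+ n * m ^+ n <= (r + C) ^+ n * vol ball1 * N.
  apply: (@le_trans _ _ ((ncard (perio m P `&` dilate r ball1))%:R * m ^+ n)).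
    by rewrite ler_wpM2r ?(ltW mn0).
  rewrite (_ : r + C = r + c2 * D + c1); last by rewrite /C; lra.
  apply: (@le_trans _ _ (m ^+ n * (cnt m (dilate (r + c2 * D) ball1))%:R * N)).
    by rewrite mulrC -mulrA ler_wpM2l ?(ltW mn0)// /N -natrM ler_nat.
  by rewrite ler_wpM2r.
move=> H.
have : (nu - e1) * m ^+ n * (r ^+ n * vol ball1) <= (1 + e1) * N * (r ^+ n * vol ball1).
  apply: (@le_trans _ _ ((r + C) ^+ n * (vol ball1 * N))).
    by move: H; congr (_ <= _); ring.
  rewrite [leRHS](_ : _ = (1 + e1) * r ^+ n * (vol ball1 * N)); last by ring.
  by rewrite ler_wpM2r// mulr_ge0// ltW.
by rewrite ler_pM2r ?mulr_gt0//; nra.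
Qed.

End periodization.

(** * Periodic approximation of packings and coverings *)

Section periodic_approximation.
Variables (R : realType) (n : nat).
Implicit Types (v w t u p : 'rV[R]_n) (m r e d : R) (S W X K P : set 'rV[R]_n).
Local Notation ball1 := (@unit_ball R n).
Local Notation star_ball := (@star_unit_ball R n).

Lemma locfin_set0 : locfin (set0 : set 'rV[R]_n).
Proof. by move=> C; rewrite set0I. Qed.

Lemma bdd_pos W : bdd W -> exists2 D, 0 <= D & forall w, W w -> `|w| <= D.
Proof.
by move=> [D hD]; exists `|D| => // w /hD h; exact: le_trans (ler_norm _).
Qed.

Lemma packs_perio K P D l m z0 : (forall k, K k -> `|k| <= D) -> 0 < l ->
  l + 2 * D <= m -> (forall p, P p -> vfloor (l^-1 *: p) = z0) ->
  packs K P -> packs K (perio m P).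
Proof.
move=> hD l0 lm hP pP x y u v [z Pz] [z' Pz'] Ku Kv E.
have l1 : 0 < l^-1 by rewrite invr_gt0.
have [zz|zz] := eqVneq z z'.
  move: Pz' Pz; rewrite -zz => Py Px.
  apply: (@addIr _ (- (m *: latpt R z))); apply: pP Px Py Ku Kv _.
  by rewrite !addrA E.
have [i zi] : exists i, z ord0 i != z' ord0 i.
  apply: contrapT => h; move/eqP: zz; apply; apply/rowP => i.
  by apply: contrapT => /eqP hi; apply: h; exists i.
exfalso.
have := vfloor_dist i (etrans (hP _ Pz) (esym (hP _ Pz'))).
have hu := le_trans (norm_coord u i) (hD _ (interior_subset Ku)).
have hv := le_trans (norm_coord v i) (hD _ (interior_subset Kv)).
move/rowP: E => /(_ i); rewrite !mxE => E.
rewrite -mulrBr normrM (gtr0_norm l1) mulrC ltr_pdivrMr// mul1r.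
have h1 : (1 : R) <= `|(z ord0 i)%:~R - (z' ord0 i)%:~R|.
  rewrite -intrB -intr_norm -[1]/(1%:~R) ler_int.
  by rewrite -gtz0_ge1 normr_gt0 subr_eq0.
move: h1 hu hv E; set a := (z ord0 i)%:~R; set b := (z' ord0 i)%:~R.
set x' := x _ _; set y' := y _ _; set u' := u _ _; set v' := v _ _.
move=> h1 hu hv E; rewrite ltr_norml => /andP[g1 g2].
have D0 : 0 <= D by exact: le_trans hu.
have m0 : 0 < m by lra.
have : m <= `|m * (a - b)|.
  by rewrite normrM gtr0_norm// -[leLHS]mulr1 ler_wpM2l// ltW.
rewrite (_ : m * (a - b) = v' - u' - (x' - m * a - (y' - m * b))); last by lra.
apply/negP; rewrite -ltNge ltr_norml.
move: hu hv; rewrite !ler_norml => /andP[a1 a2] /andP[b1 b2].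
by apply/andP; split; lra.
Qed.

Lemma packing_periodize S t X d : star S ->
  packs (translate t S) X -> (d%:E < packing_density (translates (translate t S) X))%E ->
  exists X' nu, [/\ periodic_set X', packs (translate t S) X', 0 <= nu,
    has_density X' nu & d <= nu * vol S].
Proof.
move=> sS pX hd; set K := translate t S; have VS := star_vol_gt0 sS.
(* For [d <= 0] the empty set will do; [sqr_slack] needs [0 < d]. *)
have [d0|d0] := leP d 0.
  have p0 : periodic_set (set0 : set 'rV[R]_n).
    split; first exact: locfin_set0.
    by exists 1%:M; [rewrite unitmx1|move=> x z].
  have [nu nu0 hnu] := periodic_density p0; exists set0, nu; split => //.
  by apply: le_trans d0 _; rewrite mulr_ge0// ltW.
have [d2 dd2 hd2] := ereal_lt_between hd.
have [e e0 he] := sqr_slack d0 dd2.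
have [D D0 hD] : exists2 D, 0 <= D & forall k, K k -> `|k| <= D.
  by apply: bdd_pos; rewrite /K -(dilate1 S); apply: bdd_affine; case: sS.
have D20 : 0 <= 2 * D by lra.
have [l [l0 _ hl]] := expr_shift n D20 e0.
have [hl1 _] := hl l (lexx _).
have [C C0 hC] := hits_sandwich t sS.
have [c c0 hc] := cnt_ball n l0; have [c2 c20 hc2] := star_fat star_ball.
have C'0 : 0 <= C + c2 * l + c by rewrite !addr_ge0 ?ltW// mulr_gt0.
have [R0 [R00 _ hR0]] := expr_shift n C'0 e0.
have [r Rr hr] := limf_esup_gt (R0 + C + c2 * l + c) hd2.
have cl : 0 < c2 * l by rewrite mulr_gt0.
have r0 : 0 < r by lra.
have [P [fP PX hP]] := density_in_ball_gt sS r0 hr.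
have [|hrn _] := hR0 r; first lra.
have V0 := star_vol_gt0 star_ball.
have ln0 : 0 < l ^+ n by rewrite exprn_gt0.
have rn0 : 0 < r ^+ n by rewrite exprn_gt0.
have Cr : C < r by lra.
have [k1 _] := hC X r Cr.
have rl : c2 * l < r + C by lra.
have [th _] := hc2 l (r + C) (ltW l0) rl.
have rc : c < r + C + c2 * l by lra.
have [_ hcnt] := hc _ rc; have [bB _ _] := star_ball.
(* The average number of vectors per cell of side [l] at density [d2], divided by [1 + e] to allow
   for the cells that stick out of the ball. *)
pose q := d2 * l ^+ n / (vol S * (1 + e)).
have q0 : 0 <= q by rewrite divr_ge0// mulr_ge0 ?ltW//; lra.
pose T z := P `&` [set x | vfloor (l^-1 *: x) = z].
have fT z : finite_set (T z) by exact: finite_setIl.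
have [z hz] : exists z, q <= (ncard (T z))%:R.
  apply: contrapT => /forallNP hN.
  have hk z : (ncard (T z) <= Num.truncn q)%N.
    rewrite truncn_ge_nat//; apply/ltW; rewrite ltNge; apply/negP; exact: hN.
  have : (ncard P <= cnt l (dilate (r + C + c2 * l) ball1) * Num.truncn q)%N.
    apply: (@ncard_fiber_le _ _ (fun x => vfloor (l^-1 *: x))) => //.
    - exact: (finite_cnt l0 (bdd_dilate _ bB)).
    - move=> x Px /=.
      rewrite (_ : l *: _ = x + - (x - l *: latpt R (vfloor (l^-1 *: x)))).
        by apply: th; [case: (k1 _ (PX _ Px))|rewrite normrN vfloor_scale_norm].
      by rewrite opprB addrC subrK.
    - by move=> b _; exact: hk.
  rewrite -(ler_nat R) natrM => H.
  have qn : (Num.truncn q)%:R <= q by rewrite truncn_le.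
  move: hP; rewrite ltr_pdivlMr ?ballvol_gt0// ltNge => /negP; apply.
  apply: (@le_trans _ _ ((cnt l (dilate (r + C + c2 * l) ball1))%:R * q * vol S)).
    rewrite ler_wpM2r ?(ltW VS)//; apply: le_trans H _.
    by rewrite ler_wpM2l.
  have -> : (cnt l (dilate (r + C + c2 * l) ball1))%:R * q * vol S =
     (d2 / (1 + e)) * (l ^+ n * (cnt l (dilate (r + C + c2 * l) ball1))%:R).
    by rewrite /q; field; rewrite !gt_eqF//; lra.
  have de : 0 <= d2 / (1 + e) := ltW (divr_gt0 (lt_trans d0 dd2) (addr_gt0 ltr01 e0)).
  apply: le_trans (ler_wpM2l de hcnt) _.
  rewrite -!(addrA r).
  apply: (@le_trans _ _ (d2 / (1 + e) * ((1 + e) * r ^+ n * vol ball1))).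
    by rewrite ler_wpM2l// ler_wpM2r ?(ltW V0)// addrA.
  rewrite le_eqVlt; apply/orP; left; apply/eqP; field.
  by rewrite gt_eqF//; lra.
have lm : l <= l + 2 * D by lra.
pose m := l + 2 * D.
have hTz p : T z p -> vfloor (l^-1 *: p) = z by case.
have m0 : 0 < m by exact: lt_le_trans lm.
have pp := perio_periodic m0 (fT z).
have [nu nu0 hnu] := periodic_density pp.
exists (perio m (T z)), nu; split => //.
  apply: packs_perio hD l0 (lexx _) hTz _ => x y u v [Px _] [Py _].
  by apply: pX; [case: (PX _ Px)|case: (PX _ Py)].
have mn0 : 0 < m ^+ n by rewrite exprn_gt0.
have N := perio_density_ge l0 lm (fT z) hTz hnu.
rewrite -(ler_pM2r mn0).
apply: (@le_trans _ _ (d * ((1 + e) * l ^+ n))).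
  by rewrite ler_wpM2l// ltW.
have e1 : 0 < 1 + e by lra.
rewrite mulrAC.
apply: (@le_trans _ _ (q * vol S)); last first.
  by rewrite ler_wpM2r ?(ltW VS)// (le_trans hz).
have -> : q * vol S = d2 * l ^+ n / (1 + e).
  by rewrite /q; field; rewrite !gt_eqF.
rewrite ler_pdivlMr// [leLHS](_ : _ = d * (1 + e) * (1 + e) * l ^+ n); last by ring.
by rewrite ler_wpM2r// ltW.
Qed.

(** Serves for coverings, which need not be locally finite: a bound on the density in one ball
    leaves finitely many vectors there. *)
Lemma finite_of_ncard_bound (T : choiceType) (A : set T) (M : R) :
  (forall B : set T, finite_set B -> B `<=` A -> (ncard B)%:R <= M) -> finite_set A.
Proof.
move=> h; apply: contrapT => hA.
have [B BA hB] := infinite_set_fset (Num.bound `|M|).+1 hA.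
have := h _ (finite_fset B) BA; rewrite /ncard set_fsetK; apply/negP; rewrite -ltNge.
apply: le_lt_trans (ler_norm M) _; apply: lt_le_trans (archi_boundP (normr_ge0 M)) _.
by rewrite ler_nat ltnW.
Qed.

(** A vector of [l Z^n] moves [v] into the cell of side [l] concentric with the cell of side [m];
    the translation vector that covers it is then at distance at most [D], hence in the larger
    cell. *)
Lemma covers_perio K Y D l m z0 : (forall k, K k -> `|k| <= D) -> 0 < l ->
  m = l + 2 * D -> covers K Y ->
  covers K (perio l (Y `&` [set y | vfloor (m^-1 *: y) = z0])).
Proof.
move=> hD l0 mE cY v.
pose b := m *: latpt R z0 + const_mx D.
pose w := vfloor (l^-1 *: (v - b)).
have [y Yy Ky] := cY (v - l *: latpt R w).
have D0 : 0 <= D by exact: le_trans (hD _ Ky).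
have m0 : 0 < m by lra.
exists (y + l *: latpt R w); last by rewrite opprD addrA addrAC.
exists w; rewrite addrK; split => //=.
apply/rowP => i.
have := norm_coord (v - l *: latpt R w - y) i => /le_trans/(_ (hD _ Ky)).
have := floor_le (l^-1 * (v ord0 i - b ord0 i)).
have := floorD1_gt (l^-1 * (v ord0 i - b ord0 i)).
have wE : Num.floor (l^-1 * (v ord0 i - b ord0 i)) = w ord0 i.
  by rewrite !mxE.
rewrite wE ltr_pdivrMl// ler_pdivlMl// intrD !mxE ler_norml.
move=> h1 h2 /andP[h3 h4]; apply/eqP.
rewrite floor_eq ler_pdivlMl// ltr_pdivrMl// intrD.
move: h1 h2 h3 h4; rewrite mE.
set a := (z0 _ _)%:~R; set c := (_)%:~R => h1 h2 h3 h4.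
by apply/andP; split; lra.
Qed.

Lemma covering_periodize S t Y d : star S ->
  covers (translate t S) Y -> (covering_density (translates (translate t S) Y) < d%:E)%E ->
  exists Y' nu, [/\ periodic_set Y', covers (translate t S) Y', 0 <= nu,
    has_density Y' nu & nu * vol S <= d].
Proof.
move=> sS pY hd; set K := translate t S; have VS := star_vol_gt0 sS.
have [d1 dd1 hd1] := ereal_gt_between hd.
(* A density is at least 0, as the empty set of vectors shows. *)
have d10 : 0 < d1.
  have [r r0 hr] := limf_einf_lt 0 hd1; rewrite -lte_fin; apply: le_lt_trans hr.
  have := density_in_ball_ge sS r0 (finite_set0 _) (sub0set (hits K Y r)).
  by rewrite /ncard fset_set0 cardfs0 !mul0r.
have [e e0 he] := sqr_slack d10 dd1.
have e1 : 0 < 1 + e by rewrite addr_gt0.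
have [D D0 hD] : exists2 D, 0 <= D & forall k, K k -> `|k| <= D.
  by apply: bdd_pos; rewrite /K -(dilate1 S); apply: bdd_affine; case: sS.
have D20 : 0 <= 2 * D by rewrite mulr_ge0.
have [l [l0 _ hl]] := expr_shift n D20 e0.
have [hl1 _] := hl l (lexx _).
pose m := l + 2 * D; have m0 : 0 < m by rewrite ltr_wpDr.
have [C C0 hC] := hits_sandwich t sS.
have [c c0 hc] := cnt_ball n m0; have [c2 c20 hc2] := star_fat star_ball.
have cm : 0 < c2 * m by rewrite mulr_gt0.
pose C' := C + c2 * m + c.
have C'0 : 0 < C' by rewrite !addr_gt0.
have [R0 [R00 _ hR0]] := expr_shift n (ltW C'0) e0.
have [r Rr hr] := limf_einf_lt (R0 + C') hd1.
have r0 : 0 < r by apply: lt_trans Rr; rewrite addr_gt0.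
(* The radius left after all boundary layers; [expr_shift] is applied at [s] to get
   [r ^+ n <= (1 + e) * s ^+ n]. *)
pose s := r - C'; have Rs : R0 <= s by rewrite lerBrDr ltW.
have s0 : 0 < s by exact: lt_le_trans Rs.
have sr : s + C' = r by rewrite subrK.
have [hrn _] := hR0 s Rs; rewrite sr in hrn.
have V0 := star_vol_gt0 star_ball.
have mn0 : 0 < m ^+ n by rewrite exprn_gt0.
have ln0 : 0 < l ^+ n by rewrite exprn_gt0.
have rn0 : 0 < r ^+ n by rewrite exprn_gt0.
have sn0 : 0 < s ^+ n by rewrite exprn_gt0.
have bV0 := @ballvol_gt0 _ n _ r0.
pose H := hits K Y r.
have hH P : finite_set P -> P `<=` H ->
    (ncard P)%:R < d1 * (r ^+ n * vol ball1) / vol S.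
  move=> fP PH; have := le_lt_trans (density_in_ball_ge sS r0 fP PH) hr.
  by rewrite lte_fin ltr_pdivrMr// ltr_pdivlMr.
have fH : finite_set H by apply: finite_of_ncard_bound => P fP /(hH P fP)/ltW; exact.
have hH' := hH _ fH (fun x h => h).
have Cr : C < r by rewrite -sr /C'; clear -s0 cm c0; lra.
have [_ k2] := hC Y r Cr.
have rm : c2 * m < r - C by rewrite -sr /C'; clear -s0 cm c0; lra.
have [_ th] := hc2 m (r - C) (ltW m0) rm.
have rc : c < r - C - c2 * m by rewrite -sr /C'; clear -s0 cm c0; lra.
have [hcnt _] := hc _ rc; have [bB _ _] := star_ball.
rewrite (_ : r - C - c2 * m - c = s) in hcnt; last by rewrite /s /C'; ring.
pose T z := Y `&` [set y | vfloor (m^-1 *: y) = z].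
have TH z : dilate (r - C - c2 * m) ball1 (m *: latpt R z) -> T z `<=` H.
  move=> hz y [Yy yz]; apply: k2; split => //.
  have := th _ (y - m *: latpt R z) hz; rewrite subrKC; apply.
  by rewrite -yz vfloor_scale_norm.
(* The average per cell of side [m]. Now [1 + e] multiplies, because the cells counted are those
   well inside the ball, all of whose vectors hit it. *)
pose q := d1 * (1 + e) * m ^+ n / vol S.
have q0 : 0 <= q by rewrite divr_ge0 ?(ltW VS)// !mulr_ge0 ?(ltW d10) ?(ltW e1) ?(ltW mn0).
have [z hz hzq] : exists2 z, dilate (r - C - c2 * m) ball1 (m *: latpt R z) &
    (ncard (T z))%:R <= q.
  apply: contrapT => hN.
  (* An integer above [q] is at least [truncn q + 1]. *)
  have hk z : dilate (r - C - c2 * m) ball1 (m *: latpt R z) ->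
      ((Num.truncn q).+1 <= ncard (T z))%N.
    move=> hz; rewrite ltnNge; apply/negP => h; apply: hN; exists z => //.
    by apply: (@le_trans _ _ (Num.truncn q)%:R); rewrite ?ler_nat// truncn_le.
  have : (cnt m (dilate (r - C - c2 * m) ball1) * (Num.truncn q).+1 <= ncard H)%N.
    apply: (@ncard_fiber_ge _ _ (fun y => vfloor (m^-1 *: y))) => //.
      exact: (finite_cnt m0 (bdd_dilate _ bB)).
    move=> z hz; rewrite (leq_trans (hk z hz))//; apply: ncard_sub.
      exact: finite_setIl.
    by move=> y Ty; split; [exact: TH hz _ Ty|case: Ty].
  rewrite -(ler_nat R) natrM => HH.
  have qn : q <= (Num.truncn q).+1%:R by exact/ltW/truncnS_gt.
  move: hH'; rewrite ltNge => /negP; apply; apply: le_trans HH.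
  apply: (@le_trans _ _ ((cnt m (dilate (r - C - c2 * m) ball1))%:R * q)); last first.
    by rewrite ler_wpM2l.
  have de : 0 <= d1 * (1 + e) / vol S by rewrite divr_ge0 ?(ltW VS)// mulr_ge0 ?(ltW d10) ?(ltW e1).
  have -> : (cnt m (dilate (r - C - c2 * m) ball1))%:R * q =
     d1 * (1 + e) / vol S * (m ^+ n * (cnt m (dilate (r - C - c2 * m) ball1))%:R).
    by rewrite /q; field; rewrite gt_eqF.
  apply: le_trans (ler_wpM2l de hcnt).
  have dV : 0 <= d1 * vol ball1 / vol S by rewrite divr_ge0 ?(ltW VS)// mulr_ge0 ?(ltW d10) ?(ltW V0).
  rewrite [leLHS](_ : _ = d1 * vol ball1 / vol S * r ^+ n); last by field; rewrite gt_eqF.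
  rewrite [leRHS](_ : _ = d1 * vol ball1 / vol S * ((1 + e) * s ^+ n)).
    by rewrite ler_wpM2l.
  by field; rewrite gt_eqF.
have fT : finite_set (T z) by exact: sub_finite_set (TH z hz) fH.
have pp := perio_periodic l0 fT.
have [nu nu0 hnu] := periodic_density pp.
exists (perio l (T z)), nu; split => //.
  exact: covers_perio hD l0 erefl pY.
have N := perio_density_le l0 fT hnu.
rewrite -(ler_pM2r ln0) mulrAC.
apply: (@le_trans _ _ (q * vol S)).
  by rewrite ler_wpM2r ?(ltW VS)// (le_trans N).
have -> : q * vol S = d1 * (1 + e) * m ^+ n.
  by rewrite /q; field; rewrite gt_eqF.
have dd : 0 <= d1 * (1 + e) by rewrite mulr_ge0 ?(ltW d10) ?(ltW e1).
apply: le_trans (ler_wpM2l dd hl1) _.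
by rewrite mulrA ler_wpM2r// ltW.
Qed.

End periodic_approximation.

(** * Affine comparison *)

Lemma le_of_lt_fin (R : realType) (x y : \bar R) :
  (forall d : R, (d%:E < x)%E -> (d%:E <= y)%E) -> (x <= y)%E.
Proof.
move=> h; rewrite leNgt; apply/negP; case: y h => [y| |] h yx.
- have [d dy dx] := ereal_lt_between yx.
  by have := h d dx; rewrite leNgt lte_fin dy.
- by move: yx; rewrite ltNge leey.
- have : exists d : R, (d%:E < x)%E.
    case: x yx {h} => [x _|_|]; [|by exists 0; rewrite ltry|by rewrite ltxx].
    by exists (x - 1); rewrite lte_fin ltrBlDr ltrDl.
  by move=> [d /h]; rewrite leeNy_eq.
Qed.

Lemma le_of_gt_fin (R : realType) (x y : \bar R) :
  (forall d : R, (x < d%:E)%E -> (y <= d%:E)%E) -> (y <= x)%E.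
Proof.
move=> h; rewrite -leeN2; apply: le_of_lt_fin => d.
by rewrite lteNr => /h; rewrite leeNr.
Qed.

Section affine_comparison.
Variables (R : realType) (n : nat).
Implicit Types (x y v w t u b : 'rV[R]_n) (S X Y K L : set 'rV[R]_n) (A B : 'M[R]_n).

(** The linear map is open (radius [e / C], with [C] a bound for the inverse), so it carries
    interior points of [K0] to interior points of [K]; the shift [y] occurs on both sides of the
    overlap equation and cancels. *)
Lemma packs_lin K0 K X A y : A \in unitmx -> (forall k, K0 k -> K (k *m A - y)) ->
  packs K X -> packs K0 (lin (invmx A) X).
Proof.
move=> uA h pX _ _ u v [x Xx <-] [x' Xx' <-].
have hI w : interior K0 w -> interior K (w *m A - y).
  move=> /interior_subP[e e0 he]; have [C C0 hC] := mulmx_bound (invmx A).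
  apply/interior_subP; exists (e / C); first exact: divr_gt0.
  move=> u' hu'; rewrite -addrAC -[u'](mulmxKV uA) -mulmxDl; apply/h/he.
  by rewrite (le_lt_trans (hC _))// mulrC -ltr_pdivlMr.
move=> /hI Ku /hI Kv E; rewrite (pX x x' _ _ Xx Xx' Ku Kv)//.
by rewrite 2!(addrAC _ (- y)) -[x](mulmxKV uA) -[x'](mulmxKV uA) -!mulmxDl E.
Qed.

Lemma covers_lin K0 K Y A y : A \in unitmx -> (forall k, K0 k -> K (k *m A - y)) ->
  covers K0 Y -> covers K (lin A Y).
Proof.
move=> uA h cY v; have [x Yx /h] := cY ((v + y) *m invmx A).
rewrite mulmxBl mulmxKV// addrAC addrK => Kx.
by exists (x *m A) => //; exists x.
Qed.

Lemma latticeE L : lattice L <-> exists2 B, B \in unitmx & L = lin B (range (@latpt R n)).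
Proof.
have E B : [set map_mx intr z *m B | z in [set: 'rV[int]_n]] = lin B (range (@latpt R n)).
  apply/seteqP; split => [_ [z _ <-]|_ [_ [z _ <-] <-]]; last by exists z.
  by exists (latpt R z) => //; exists z.
by split=> [[B [uB ->]]|[B uB ->]]; exists B.
Qed.

Lemma lattice_lin L A : A \in unitmx -> lattice L -> lattice (lin A L).
Proof.
move=> uA /latticeE[B uB ->]; apply/latticeE; exists (B *m A); first by rewrite unitmx_mul uB.
apply/seteqP; split => [_ [_ [z Zz <-] <-]|_ [z Zz <-]].
  by exists z => //; rewrite mulmxA.
by exists (z *m B); [exists z|rewrite mulmxA].
Qed.

Lemma lattice_periodic L : lattice L -> periodic_set L.
Proof.
move=> /latticeE[B uB ->]; apply: periodic_lin => //; split.
  move=> C; apply: (sub_finite_set _ (finite_image (@latpt R n) (finite_latpt n C))).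
  by move=> _ [[z _ <-] hz]; exists z.
exists 1%:M; first exact: unitmx1.
by move=> _ z [z' _ <-]; exists (z' + z) => //; rewrite latptD mulmx1.
Qed.

Section comparison.
Variables (K K0 S S0 : set 'rV[R]_n) (t t0 y : 'rV[R]_n) (A : 'M[R]_n) (r : R).
Hypotheses (KE : K = translate t S) (K0E : K0 = translate t0 S0)
  (sS : star S) (sS0 : star S0) (uA : A \in unitmx) (r0 : 0 < r)
  (K0K : forall k, K0 k -> K (k *m A - y))
  (volK : vol S <= r ^+ n * vol (lin A S0)).

(** The density identity is used with the body [lin A S0], which [invmx A] sends back to [S0];
    [volK] then trades its volume for that of [S]. *)
Lemma packing_density_compare X nu : periodic_set X -> 0 <= nu -> has_density X nu ->
  ((nu * vol S)%:E <=
     (r ^+ n)%:E * packing_density (translates K0 (lin (invmx A) X)))%E.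
Proof.
move=> pX nu0 hX; have uA' : invmx A \in unitmx by rewrite unitmx_inv.
have [nu' [nu'0 hY E]] := periodic_density_lin pX hX uA' (star_lin uA sS0).
have [fY _] := periodic_lin uA' pX.
rewrite K0E (packing_density_periodic t0 sS0 fY nu'0 hY) -EFinM lee_fin.
rewrite linK// in E; rewrite E mulrCA; exact: ler_wpM2l.
Qed.

Lemma covering_density_compare Y nu : periodic_set Y -> 0 <= nu -> has_density Y nu ->
  (covering_density (translates K (lin A Y)) <= (r ^+ n * (nu * vol S0))%:E)%E.
Proof.
move=> pY nu0 hY.
have [nu' [nu'0 hX E]] := periodic_density_lin pY hY uA sS0.
have [fX _] := periodic_lin uA pY.
rewrite KE (covering_density_periodic t sS fX nu'0 hX) lee_fin -E mulrCA.
exact: ler_wpM2l.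
Qed.

Let rn0 : 0 < r ^+ n := exprn_gt0 n r0.
Let bK : bdd K.
Proof. by rewrite KE -(dilate1 S); apply: bdd_affine; case: sS. Qed.
Let K_neq0 : K !=set0.
Proof. by have [_ [s Ss] _] := sS; exists (s + t); rewrite KE; exists s. Qed.

Lemma delta_t_compare : (delta_t K <= (r ^+ n)%:E * delta_t K0)%E.
Proof.
(* Periodization reaches every real [d] below the density, which could a priori be infinite. *)
apply: ge_ereal_sup => _ [X pX <-]; apply: le_of_lt_fin => d hd.
have {}pX := packing_packs bK K_neq0 pX.
move: pX hd; rewrite {1 2}KE => pX hd.
have [X' [nu [pX' kX' nu0 hX' dnu]]] := packing_periodize sS pX hd.
rewrite -KE in kX'.
apply: (@le_trans _ _ (nu * vol S)%:E); first by rewrite lee_fin.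
apply: le_trans (packing_density_compare pX' nu0 hX') _.
rewrite lee_wpmul2l ?lee_fin ?(ltW rn0)//; apply: ereal_sup_ubound.
exists (lin (invmx A) X') => //=; apply: packs_packing; last exact: packs_lin uA K0K kX'.
have uA' : invmx A \in unitmx by rewrite unitmx_inv.
by apply: locfin_countable; have [] := periodic_lin uA' pX'.
Qed.

Lemma delta_l_compare : (delta_l K <= (r ^+ n)%:E * delta_l K0)%E.
Proof.
apply: ge_ereal_sup => _ [L [lL pL] <-].
have {}pL := packing_packs bK K_neq0 pL.
have pX := lattice_periodic lL; have [fL _] := pX.
have [nu nu0 hL] := periodic_density pX.
rewrite {1}KE (packing_density_periodic t sS fL nu0 hL).
apply: le_trans (packing_density_compare pX nu0 hL) _.
have uA' : invmx A \in unitmx by rewrite unitmx_inv.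
rewrite lee_wpmul2l ?lee_fin ?(ltW rn0)//; apply: ereal_sup_ubound.
exists (lin (invmx A) L) => //=; split; first exact: lattice_lin.
apply: packs_packing; last exact: packs_lin uA K0K pL.
by apply: locfin_countable; have [] := periodic_lin uA' pX.
Qed.

Lemma theta_t_compare : (theta_t K <= (r ^+ n)%:E * theta_t K0)%E.
Proof.
rewrite -lee_pdivrMl//; apply: le_ereal_inf_tmp => _ [Y cY <-].
apply: le_of_gt_fin => d hd; rewrite lee_pdivrMl// -EFinM.
have {}cY := covering_covers cY.
move: cY hd; rewrite {1 2}K0E => cY hd.
have [Y' [nu [pY' kY' nu0 hY' dnu]]] := covering_periodize sS0 cY hd.
rewrite -K0E in kY'.
apply: (@le_trans _ _ (r ^+ n * (nu * vol S0))%:E); last first.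
  by rewrite lee_fin ler_wpM2l// ltW.
apply: le_trans (covering_density_compare pY' nu0 hY').
apply: ereal_inf_lbound; exists (lin A Y') => //=.
apply: covers_covering; last exact: covers_lin uA K0K kY'.
by apply: locfin_countable; have [] := periodic_lin uA pY'.
Qed.

Lemma theta_l_compare : (theta_l K <= (r ^+ n)%:E * theta_l K0)%E.
Proof.
rewrite -lee_pdivrMl//; apply: le_ereal_inf_tmp => _ [L [lL cL] <-]; rewrite lee_pdivrMl//.
have {}cL := covering_covers cL.
have pY := lattice_periodic lL; have [fL _] := pY.
have [nu nu0 hL] := periodic_density pY.
rewrite {1}K0E (covering_density_periodic t0 sS0 fL nu0 hL) -EFinM.
apply: le_trans (covering_density_compare pY nu0 hL).
apply: ereal_inf_lbound; exists (lin A L) => //=; split; first exact: lattice_lin.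
apply: covers_covering; last exact: covers_lin uA K0K cL.
by apply: locfin_countable; have [] := periodic_lin uA pY.
Qed.

End comparison.

Definition mazur_ratio K K0 := [set r : R | 0 < r /\
  exists x sigma, [/\ nonsingular_affine sigma, K `<=` sigma @` K0
    & sigma @` K0 `<=` translate x (dilate r K)]].

(** [K] lies in a translate of [r K], so [1 <= r ^+ n] by volume, and [0 < n] gives [1 <= r]. This
    makes the infimum positive, as needed to undo the logarithm. *)
Lemma mazur_ratio_ge1 K K0 r : (0 < n)%N -> convex_body K -> mazur_ratio K K0 r -> 1 <= r.
Proof.
move=> n0 hK [r0 [x [sigma [_ h1 h2]]]].
have [t [S [sS KE]]] := convex_body_star hK.
have [bS _ _] := sS; have V0 := star_vol_gt0 sS.
have : vol K <= vol (translate (r *: t + x) (dilate r S)).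
  apply: vol_mono; first exact: bdd_affine.
  by move=> k /h1/h2; rewrite {1}KE dilate_translate translateD.
rewrite {1}KE vol_translate// vol_affine// ler_pMl//.
by rewrite leNgt => h; rewrite leNgt; apply: contra h => h; rewrite exprn_ilt1 ?(ltW r0)// -lt0n.
Qed.

(** Ensures that the infimum is not a default value. [K0], centred at the interior point [p0], is
    inflated by [s] until its inner cube of radius [e'] exceeds the bound [D] of [K]; likewise [r]
    makes the inner cube of [K] exceed the bound [2 * s * D'] of the inflated [K0]. The summands 1
    give strict inequalities. *)
Lemma mazur_ratio_neq0 K K0 : convex_body K -> convex_body K0 -> mazur_ratio K K0 !=set0.
Proof.
move=> [cK _ [p Kp]] [cK0 _ [p0 Kp0]].
have [D D0 hD] := bdd_pos (bdd_compact cK).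
have [D' D'0 hD'] := bdd_pos (bdd_compact cK0).
have /interior_subP[e e0 he] := Kp; have /interior_subP[e' e'0 he'] := Kp0.
pose s := (D + 1) / e'; have s0 : 0 < s by rewrite divr_gt0// ltr_wpDl.
pose r := (2 * s * D' + 1) / e.
have sD : 0 <= 2 * s * D' by rewrite mulr_ge0// mulr_ge0// ltW.
have r0 : 0 < r by rewrite divr_gt0// ltr_wpDl.
exists r; split=> //; exists (- (r *: p)), (fun v => v *m s%:M + - (s *: p0)); split.
- by exists s%:M, (- (s *: p0)); split => //; rewrite unitmxE det_scalar unitfE expf_neq0// gt_eqF.
- move=> k Kk; exists (p0 + s^-1 *: k).
    apply: he'; rewrite normrZ gtr0_norm ?invr_gt0// mulrC ltr_pdivrMr//.
    by rewrite (le_lt_trans (hD _ Kk))// /s mulrC mulfVK ?gt_eqF// ltrDl.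
  by rewrite mul_mx_scalar scalerDr scalerA divff ?gt_eqF// scale1r addrAC subrr add0r.
move=> _ [k Kk <-]; exists (r *: (p + r^-1 *: (s *: k - s *: p0))).
  exists (p + r^-1 *: (s *: k - s *: p0)) => //; apply: he.
  rewrite normrZ gtr0_norm ?invr_gt0// mulrC ltr_pdivrMr// -scalerBr normrZ gtr0_norm//.
  rewrite (_ : e * r = 2 * s * D' + 1); last by rewrite /r mulrC mulfVK ?gt_eqF.
  apply: (@le_lt_trans _ _ (s * (D' + D'))); last by clear -s0 D'0; lra.
  rewrite ler_wpM2l ?(ltW s0)// (le_trans (ler_normB _ _))// lerD ?hD'//.
  exact: interior_subset.
by rewrite scalerDr scalerA divff ?gt_eqF// scale1r addrAC subrr add0r mul_mx_scalar.
Qed.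

Lemma mazur_ratio_compare K K0 r (f : set 'rV[R]_n -> \bar R) :
  f = @theta_t R n \/ f = @theta_l R n \/ f = @delta_t R n \/ f = @delta_l R n ->
  convex_body K -> convex_body K0 -> mazur_ratio K K0 r ->
  (f K <= (r ^+ n)%:E * f K0)%E.
Proof.
move=> hf hK hK0 [r0 [x [_ [[A [b [uA ->]]] h1 h2]]]].
have [t [S [sS KE]]] := convex_body_star hK.
have [t0 [S0 [sS0 K0E]]] := convex_body_star hK0.
pose A' := r^-1 *: A.
have uA' : A' \in unitmx by rewrite unitmxZ// unitfE invr_eq0 gt_eqF.
have K0K k : K0 k -> K (k *m A' - r^-1 *: (x - b)).
  move=> Kk; have [_ [k' Kk' <-] E] := h2 _ (ex_intro2 _ _ k Kk erefl).
  rewrite -scalemxAr -scalerBr (_ : k *m A - (x - b) = r *: k').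
    by rewrite scalerA mulVf ?gt_eqF// scale1r.
  by rewrite opprB addrA -E addrK.
have linA : lin A S0 = dilate r (lin A' S0).
  rewrite -lin_dilate /A'; apply/seteqP; split => [_ [s Ss <-]|_ [_ [s Ss <-] <-]].
    by exists (r *: s); [exists s|rewrite -scalemxAl -scalemxAr scalerA divff ?gt_eqF// scale1r].
  by exists s => //; rewrite -scalemxAl -scalemxAr scalerA divff ?gt_eqF// scale1r.
(* The first inclusion puts [K] in a translate of [dilate r (lin A' S0)]. *)
have volK : vol S <= r ^+ n * vol (lin A' S0).
  have sA := star_lin uA' sS0; have [bA _ _] := sA.
  rewrite -(vol_affine (t0 *m A + b) sA r0) -(vol_translate t sS) -KE.
  apply: vol_mono; first exact: bdd_affine.
  move=> k /h1[k0 Kk0 <-]; rewrite -linA; move: Kk0; rewrite K0E => -[s Ss <-].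
  by exists (s *m A); [exists s|rewrite mulmxDl addrA].
case: hf => [->|[->|[->|->]]].
- exact: (theta_t_compare KE K0E sS sS0 uA' r0 K0K volK).
- exact: (theta_l_compare KE K0E sS sS0 uA' r0 K0K volK).
- exact: (delta_t_compare KE K0E sS sS0 uA' r0 K0K volK).
- exact: (delta_l_compare KE K0E sS sS0 uA' r0 K0K volK).
Qed.

End affine_comparison.

Theorem theorem3 (R : realType) (n : nat) (hn : (1 <= n)%N)
  (f : set 'rV[R]_n -> \bar R)
  (hf : f = @theta_t R n \/ f = @theta_l R n \/
        f = @delta_t R n \/ f = @delta_l R n)
  (K0 : set 'rV[R]_n) (hK0 : convex_body K0)
  (K : set 'rV[R]_n) (hK : convex_body K) :
  (f K <= (expR (n%:R * banach_mazur K K0))%:E * f K0)%E.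
Proof.
have cmp r : mazur_ratio K K0 r -> (f K <= (r ^+ n)%:E * f K0)%E.
  exact: mazur_ratio_compare hf hK hK0.
have ge1 r : mazur_ratio K K0 r -> 1 <= r by exact: mazur_ratio_ge1.
have [r1 hr1] := mazur_ratio_neq0 hK hK0.
have hi : has_inf (mazur_ratio K K0) by split; [exists r1|exists 1].
rewrite /banach_mazur -/(mazur_ratio K K0); set m := inf _.
have m1 : 1 <= m by apply: lb_le_inf; [exists r1|exact: ge1].
have m0 : 0 < m by exact: lt_le_trans m1.
have mr1 : m <= r1 by apply: ge_inf => //; exists 1.
rewrite expRM_natl lnK ?posrE//.
have mn0 : 0 < m ^+ n by rewrite exprn_gt0.
have r1n : 0 < r1 ^+ n by rewrite exprn_gt0// (lt_le_trans m0).
(* No sign or finiteness of [f K0] is presupposed. For a nonnegative real value, ratios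
   [r < m * (1 + e)] approach the infimum; for a negative one the bound with [r1] suffices, as
   [m <= r1]. *)
case: (f K0) cmp => [y| |] cmp.
- have [y0|y0] := leP 0 y.
    move: cmp; case: (f K) => [x| |] cmp; last by rewrite leNye.
      rewrite -EFinM lee_fin; apply: (@le_expr1D_lim _ n); first by rewrite mulr_ge0// ltW.
      move=> e e0; have [r hr rm] := inf_adherent (mulr_gt0 m0 e0) hi.
      have := cmp r hr; rewrite -EFinM lee_fin => /le_trans; apply.
      rewrite mulrAC ler_wpM2r// -exprMn lerXn2r ?nnegrE//.
      + by rewrite (le_trans ler01)// ge1.
      + by rewrite mulr_ge0 ?(ltW m0)// addr_ge0// ltW.
      + by rewrite mulrDr mulr1 ltW.
    by have := cmp r1 hr1; rewrite -EFinM leye_eq.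
  apply: le_trans (cmp r1 hr1) _; rewrite -!EFinM lee_fin ler_wnM2r ?(ltW y0)//.
  by rewrite lerXn2r ?nnegrE ?(ltW m0)// (le_trans ler01)// ge1.
- by rewrite gt0_muley ?lte_fin// leey.
- by have := cmp r1 hr1; rewrite !gt0_muleNy ?lte_fin.
Qed.
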